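(* Let $\Omega$ be an open, strictly convex subset of $\mathbb{R}^2$ with smooth boundary, axially symmetric (i.e. $(x,y)\in\Omega$ implies $(-x,y),(x,-y)\in\Omega$), and satisfying \[ [-1,1]\times[-1,1]\subset\Omega\subset[-\tfrac43,\tfrac43]\times[-\tfrac43,\tfrac43]. \] Let $u:\Omega\to\mathbb{R}$ be a convex solution of \[ \frac{\det D^2u}{(1+|Du|^2)^{3/2}}=\frac{2\pi}{\mathcal{A}(\Omega)}\ \text{in }\Omega,\qquad \lim_{x\to\partial\Omega}|Du|(x)=+\infty, \] where $\mathcal{A}(\Omega)$ is the area of $\Omega$. Then for all $\epsilon\in(0,1/2)$ and $\alpha\in(0,1/6)$, \[ \partial_x u(1-5\alpha,-1+\epsilon)\le 2+3\cot\frac{\pi\alpha^2}{2}. \] *)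

(* Defs.v *)
From HB Require Import structures.
From mathcomp Require Import all_boot all_order all_algebra.
From mathcomp Require Import all_classical all_reals all_analysis.
Set Implicit Arguments. Unset Strict Implicit. Unset Printing Implicit Defensive.
Import Order.TTheory GRing.Theory Num.Theory numFieldNormedType.Exports.
Local Open Scope classical_set_scope.
Local Open Scope ring_scope.

Section Defs.
Variable R : realType.
Implicit Types (f : R * R -> R) (D : set (R * R)).

Definition pdx f (p : R * R) : R := derive1 (fun t => f (t, p.2)) p.1.
Definition pdy f (p : R * R) : R := derive1 (fun t => f (p.1, t)) p.2.

Fixpoint Ck (k : nat) D f : Prop :=
  match k with
  | 0 => forall x, D x -> {for x, continuous f}
  | k'.+1 =>
      (forall x, D x -> {for x, continuous f}) /\
      (forall x, D x -> derivable (fun t => f (t, x.2)) x.1 1 /\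
                        derivable (fun t => f (x.1, t)) x.2 1) /\
      Ck k' D (pdx f) /\ Ck k' D (pdy f)
  end.

Definition smooth_on D f : Prop := forall k, Ck k D f.

Definition smooth_boundary D : Prop :=
  exists rho : R * R -> R,
    smooth_on setT rho /\
    (forall p, D p <-> rho p < 0) /\
    (forall p, rho p = 0 -> (pdx rho p, pdy rho p) != (0, 0)).

Definition convex_comb (t : R) (p q : R * R) : R * R :=
  (t * p.1 + (1 - t) * q.1, t * p.2 + (1 - t) * q.2).

Definition strictly_convex_set D : Prop :=
  forall p q t, closure D p -> closure D q -> p <> q -> 0 < t < 1 ->
    D (convex_comb t p q).

Definition convex_fun_on D f : Prop :=
  forall p q t, D p -> D q -> 0 <= t <= 1 ->
    f (convex_comb t p q) <= t * f p + (1 - t) * f q.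

Definition axially_symmetric D : Prop :=
  forall x y, D (x, y) -> D (- x, y) /\ D (x, - y).

Definition square (a : R) : set (R * R) :=
  [set p | - a <= p.1 <= a /\ - a <= p.2 <= a].

Definition area D : R :=
  fine ((@lebesgue_measure R \x @lebesgue_measure R) D)%E.

Definition enorm (v : R * R) : R := Num.sqrt (v.1 ^+ 2 + v.2 ^+ 2).

Definition grad f (p : R * R) : R * R := (pdx f p, pdy f p).

Definition hess_det f (p : R * R) : R :=
  pdx (pdx f) p * pdy (pdy f) p - pdy (pdx f) p * pdx (pdy f) p.

Definition boundary D : set (R * R) := closure D `\` D.

Definition grad_blowup D f : Prop :=
  forall b, boundary D b -> forall M : R, exists2 d : R, 0 < d &
    forall x, D x -> enorm (x.1 - b.1, x.2 - b.2) < d -> M < enorm (grad f x).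

Definition cot (x : R) : R := cos x / sin x.

End Defs.

(* Main.v *)
(** Everything follows from the maximum principle for det D^2u = K (1 + |Du|^2)^(3/2),
    where K = 2 pi / A(Omega) >= 9 pi / 32.

    First, u decreases in y on the half-plane y < 0.  Reflect the cap Omega /\ {y < l},
    l < 0, in the line y = l.  The difference w of u and its reflection vanishes on
    that line and, since u_y tends to -oo at the boundary of Omega below the x-axis,
    w decreases upwards near the curved part of the cap.  So a negative minimum of w
    would be interior; replacing the reflected function g by s g (. / s), with s < 1
    close to 1, keeps gradients and multiplies Hessian determinants by s^-2, which is
    incompatible with an interior minimum.

    Next, compare u on the box [1 - 3 al, 1] x [y0, y0 + 3 al], where y0 = -1 + eps, with
    v = (9 / K) (sqrt (1 - x) + sqrt (Y - Y^2 / (4 al)) / 2)^-2, where Y = y - y0.  It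
    satisfies v_xx v_yy < K (1 + |Dv|^2)^(3/2), so u - v has no interior maximum, and its
    slopes leave only the left side: u - v is maximal at some z with z.1 = 1 - 3 al and
    u_x z <= v_x z, while u_y z <= 0.  Two tangent-plane inequalities, at z and at
    p = (1 - 5 al, y0), then give 2 al u_x p <= v (1 - 3 al, y0) <= 3 / (K al), and
    3 / (2 K al^2) <= 3 cot (pi al^2 / 2). *)
Require Import Defs.
From HB Require Import structures.
From mathcomp Require Import all_boot all_order all_algebra.
From mathcomp Require Import ring lra.
From mathcomp Require Import all_classical all_reals all_analysis.
Import Order.TTheory GRing.Theory Num.Theory numFieldNormedType.Exports.
Local Open Scope classical_set_scope.
Local Open Scope ring_scope.

Set Implicit Arguments. Unset Strict Implicit. Unset Printing Implicit Defensive.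

(** * Real functions of one variable *)

Section Calculus.
Variable R : realType.
Implicit Types (F dF f g : R -> R) (x l r h : R) (u : R * R -> R) (D : set (R * R)).

Lemma near0P (P : R -> Prop) (x : R) :
  (\forall y \near x, P y) <-> exists2 e : R, 0 < e & forall h, `|h| < e -> P (x + h).
Proof.
split=> [/nbhs_ballP[e /= e0 He]|[e e0 He]].
  exists e => // h he; apply: He; rewrite /ball/= opprD addrA subrr add0r normrN //.
apply/nbhs_ballP; exists e => //= y; rewrite /ball/= => xy.
have -> : y = x + (y - x) by ring.
by apply: He; rewrite distrC.
Qed.

Lemma is_derive_eps F x l :
  (forall e : R, 0 < e -> exists2 d : R, 0 < d & forall h, `|h| < d ->
     `|F (x + h) - F x - l * h| <= e * `|h|) ->
  is_derive x 1 F l.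
Proof.
move=> H.
have cv : h^-1 *: ((F \o shift x) (h *: 1) - F x) @[h --> (0 : R)^'] --> l.
  apply/cvgrPdist_le => e e0; have [d d0 Hd] := H _ e0.
  near=> h.
  have h0 : h != 0 by near: h; exact: nbhs_dnbhs_neq.
  have hd : `|h| < d.
    near: h; apply: dnbhs0_lt => //.
  rewrite /= [h *: 1]mulr1 [h^-1 *: _]/(h^-1 * _) (addrC h).
  have -> : l - h^-1 * (F (x + h) - F x) = - (h^-1 * (F (x + h) - F x - l * h)).
    by field.
  rewrite normrN normrM normfV mulrC ler_pdivrMr ?normr_gt0 //.
  exact: Hd.
apply: DeriveDef; first by apply/cvg_ex; exists l.
exact: cvg_lim cv.
Unshelve. all: by end_near. Qed.

Lemma derive_epsP F x l : is_derive x 1 F l ->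
  forall e : R, 0 < e -> exists2 d : R, 0 < d & forall h, `|h| < d ->
     `|F (x + h) - F x - l * h| <= e * `|h|.
Proof.
move=> /is_derive1_caratheodory [g [Fg cg gl]] e e0.
have /cvgrPdist_le/(_ _ e0)/near0P[d d0 Hd] := cg.
exists d => // h hd; rewrite Fg -gl.
have -> : g (x + h) * (x + h - x) - g x * h = - ((g x - g (x + h)) * h) by ring.
by rewrite normrN normrM ler_wpM2r // Hd.
Qed.

Lemma is_derive_continuous F x l : is_derive x 1 F l -> {for x, continuous F}.
Proof.
by move=> H; apply/differentiable_continuous/derivable1_diffP; case: H.
Qed.

(** The increment [h] may have either sign and the intermediate point is given as a displacement
    [k], the form in which the estimates in the plane use the mean value theorem. *)
Lemma mvt_ball F dF x r h : 
  (forall k : R, `|k| < r -> is_derive (x + k) 1 F (dF (x + k))) -> `|h| < r ->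
  exists2 k : R, `|k| <= `|h| & F (x + h) - F x = dF (x + k) * h.
Proof.
move=> dFr hr.
have dF' (a b : R) : `|a - x| <= `|h| -> `|b - x| <= `|h| -> forall y : R, a <= y <= b ->
     is_derive y 1 F (dF y).
  move=> ax bx y /andP[ay yb].
  have -> : y = x + (y - x) by ring.
  apply: dFr; apply: le_lt_trans hr.
  move: ax bx; rewrite !ler_norml => /andP[? ?] /andP[? ?].
  by apply/andP; split; lra.
have key (a b : R) : `|a - x| <= `|h| -> `|b - x| <= `|h| -> a <= b ->
    exists2 c : R, a <= c <= b & F b - F a = dF c * (b - a).
  move=> ax bx ab.
  have dd := dF' a b ax bx.
  have [||c cab E] := @MVT_segment R F dF a b ab.
  - by move=> y; rewrite in_itv/= => /andP[? ?]; apply: dd; rewrite !ltW.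
  - apply: derivable_within_continuous => y; rewrite in_itv/= => yab.
    by case: (dd _ yab).
  by exists c.
have [h0|h0] := leP 0 h.
  have [|||c /andP[c1 c2] E] := key x (x + h).
  - by rewrite subrr normr0.
  - by have -> : x + h - x = h by ring.
  - by rewrite lerDl.
  exists (c - x); first by rewrite !ger0_norm; lra.
  by rewrite E (_ : x + (c - x) = c); ring.
have [|||c /andP[c1 c2] E] := key (x + h) x.
- by have -> : x + h - x = h by ring.
- by rewrite subrr normr0.
- by rewrite gerDl ltW.
exists (c - x); first by rewrite (ltr0_norm h0) ler0_norm; lra.
have -> : x + (c - x) = c by ring.
by move/(congr1 -%R): E; rewrite opprB => ->; ring.
Qed.

(** If [l < 0], then [dF], which vanishes at [x], is negative just to the right of [x], and the mean
    value theorem makes [F] drop below its minimum. *)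
Lemma second_derivative_test F dF x l :
  (\forall y \near x, is_derive (y : R) 1 F (dF y)) -> is_derive x 1 dF l ->
  (\forall y \near x, F x <= F y) -> dF x = 0 /\ 0 <= l.
Proof.
move=> /near0P[r r0 Hr] ddF /near0P[m m0 Hm].
set s := Num.min r m.
have s0 : 0 < s by rewrite lt_min r0.
have dF0 : dF x = 0.
  have [||||dv <-] := @derive1_at_min R F (x - s) (x + s) x.
  - by lra.
  - move=> t; rewrite in_itv/= => /andP[t1 t2].
    have -> : t = x + (t - x) by ring.
    have [] // := Hr (t - x).
    have : `|t - x| < s by rewrite ltr_norml; apply/andP; split; lra.
    by rewrite lt_min => /andP[].
  - by rewrite in_itv/=; lra.
  - move=> t; rewrite in_itv/= => /andP[t1 t2].
    have -> : t = x + (t - x) by ring.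
    apply: Hm.
    have : `|t - x| < s by rewrite ltr_norml; apply/andP; split; lra.
    by rewrite lt_min => /andP[].
  have H0 := Hr 0; rewrite normr0 addr0 in H0.
  by have [_ ->] := H0 r0.
split => //.
rewrite leNgt; apply/negP => l0.
have [|d d0 Hd] := derive_epsP ddF (e := - l / 2).
  by lra.
pose h := Num.min d s / 2.
have hs : 0 < Num.min d s by rewrite lt_min d0.
have [hd hs'] : h < d /\ h < s.
  have : Num.min d s <= d /\ Num.min d s <= s by split; rewrite ge_min lexx ?orbT.
  by rewrite /h; case; split; lra.
have h0 : 0 < h by rewrite /h; lra.
have [hr hm] : h < r /\ h < m.
  by move: hs'; rewrite lt_min => /andP[].
have [|||c] := @MVT R F dF x (x + h).
- by lra.
- move=> y; rewrite in_itv/= => /andP[y1 y2].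
  have -> : y = x + (y - x) by ring.
  by apply: Hr; rewrite gtr0_norm; lra.
- apply: derivable_within_continuous => y; rewrite in_itv/= => /andP[y1 y2].
  have -> : y = x + (y - x) by ring.
  by have [] // := Hr (y - x); rewrite ger0_norm; lra.
rewrite in_itv/= => /andP[c1 c2] E.
have /(_ h) := Hm; rewrite gtr0_norm // => /(_ hm); rewrite -subr_ge0 E.
have /(_ (c - x)) := Hd; rewrite gtr0_norm; last lra.
have -> : x + (c - x) = c by ring.
rewrite dF0 subr0 => /(_ _)/ler_normlP[|_ H]; first by lra.
have : dF c < 0 by nra.
have -> : x + h - x = h by ring.
nra.
Qed.

(** The tool against an extremum on the edge of a region: one step [h], as short as desired, serves
    to the right and to the left. *)
Lemma derive_lt0_step (F : R -> R) (x l r : R) : is_derive x 1 F l -> l < 0 ->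
  0 < r -> exists2 h, 0 < h < r & F (x + h) < F x /\ F x < F (x - h).
Proof.
move=> dF l0 r0; have [|d d0 Hd] := derive_epsP dF (e := - l / 2).
  by rewrite divr_gt0 // oppr_gt0.
pose h := Num.min r d / 2.
have m0 : 0 < Num.min r d by rewrite lt_min r0.
have h0 : 0 < h by rewrite divr_gt0.
have : h < Num.min r d by rewrite /h ltr_pdivrMr // mulr_natr mulr2n ltrDl.
rewrite lt_min => /andP[hr hd].
exists h; first by rewrite h0.
have lh : l * h < 0 by rewrite nmulr_rlt0.
have := Hd h; rewrite gtr0_norm // => /(_ hd)/ler_normlP[_ h1].
have := Hd (- h); rewrite normrN gtr0_norm // => /(_ hd)/ler_normlP[h2 _].
by move: lh h1 h2; clear; split; lra.
Qed.

End Calculus.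

(** * Twice differentiable functions on the plane *)

Section Plane.
Variable R : realType.
Implicit Types (f fx fy u ux uy uxx uxy uyx uyy : R * R -> R) (D : set (R * R)) (p d q : R * R).

Lemma near_planeP (P : R * R -> Prop) p :
  (\forall q \near p, P q) <->
  exists2 e : R, 0 < e & forall a b : R, `|a| < e -> `|b| < e -> P (p.1 + a, p.2 + b).
Proof.
split=> [/nbhs_ballP[e /= e0 He]|[e e0 He]].
  exists e => // a b ae be; apply: He; split; rewrite /= /ball/=;
  by rewrite opprD addrA subrr add0r normrN.
apply/nbhs_ballP; exists e => //= -[y1 y2] [] /=; rewrite /ball/= => xy1 xy2.
have -> : (y1, y2) = (p.1 + (y1 - p.1), p.2 + (y2 - p.2)) by congr (_, _); ring.
by apply: He; rewrite distrC.
Qed.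

Lemma open_planeP D p : open D -> D p ->
  exists2 e : R, 0 < e & forall a b : R, `|a| < e -> `|b| < e -> D (p.1 + a, p.2 + b).
Proof. by move=> oD Dp; apply/near_planeP; exact: open_nbhs_nbhs. Qed.

Lemma continuous_planeP f p : {for p, continuous f} <->
  forall e : R, 0 < e -> exists2 r : R, 0 < r & forall a b : R,
    `|a| < r -> `|b| < r -> `|f (p.1 + a, p.2 + b) - f p| < e.
Proof.
split=> [cf e e0|H].
  apply/(near_planeP (fun q => `|f q - f p| < e)); near=> q; rewrite distrC; near: q.
  exact: ((cvgrPdist_lt _ _).1 cf e e0).
apply/cvgrPdist_lt => e e0.
have /(near_planeP (fun q => `|f q - f p| < e)) := H e e0.
by apply: filterS => q; rewrite distrC.
Unshelve. all: by end_near. Qed.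

(** With explicit partial derivatives the same predicate, applied again to [fx] and [fy], expresses
    second-order regularity. *)
Definition C1_partials D f fx fy := forall x y : R, D (x, y) ->
  [/\ is_derive x 1 (fun t => f (t, y)) (fx (x, y)),
      is_derive y 1 (fun t => f (x, t)) (fy (x, y)),
      {for (x, y), continuous fx} & {for (x, y), continuous fy}].

Definition line p d (t : R) : R * R := (p.1 + t * d.1, p.2 + t * d.2).

Lemma line0 p d : line p d 0 = p.
Proof. by rewrite /line !mul0r !addr0; case: p. Qed.

(** The increment is cut into a horizontal and a vertical one, each is treated by the mean value
    theorem, and continuity of the partials moves the intermediate points to the base point. *)
Lemma is_derive_line D f fx fy p d (t : R) : open D -> C1_partials D f fx fy -> D (line p d t) ->
  is_derive t 1 (fun s => f (line p d s))
    (d.1 * fx (line p d t) + d.2 * fy (line p d t)).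
Proof.
move=> oD Cf Dp; apply: is_derive_eps => e e0.
have Eq (h : R) : line p d (t + h) =
  ((line p d t).1 + h * d.1, (line p d t).2 + h * d.2).
  by rewrite /line /=; congr (_, _); ring.
rewrite -{-4}/(line p d t); move: (line p d t) Dp Eq => {}p' Dp Eq.
pose M : R := `|d.1| + `|d.2| + 1.
have M0 : 0 < M by rewrite /M; have := normr_ge0 d.1; have := normr_ge0 d.2; lra.
have eM : 0 < e / M by rewrite divr_gt0.
have [r1 r10 H1] := open_planeP oD Dp.
have [_ _ cx cy] := Cf _ _ (eq_ind p' D Dp _ (surjective_pairing p')).
rewrite -surjective_pairing in cx cy.
have [r2 r20 H2] := (continuous_planeP _ _).1 cx _ eM.
have [r3 r30 H3] := (continuous_planeP _ _).1 cy _ eM.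
pose r := Num.min r1 (Num.min r2 r3).
have r0 : 0 < r by rewrite !lt_min r10 r20.
exists (r / M); first by rewrite divr_gt0.
move=> h hr; rewrite Eq.
have hM : `|h| * M < r by rewrite -ltr_pdivlMr.
have h1 : `|h * d.1| < r.
  apply: le_lt_trans hM; rewrite normrM ler_wpM2l // /M.
  by have := normr_ge0 d.2; lra.
have h2 : `|h * d.2| < r.
  apply: le_lt_trans hM; rewrite normrM ler_wpM2l // /M.
  by have := normr_ge0 d.1; lra.
have rr (a : R) : `|a| < r -> [/\ `|a| < r1, `|a| < r2 & `|a| < r3].
  by rewrite !lt_min => /and3P[].
have [||k1 k1h E1] := @mvt_ball R (fun s => f (s, p'.2 + h * d.2))
  (fun s => fx (s, p'.2 + h * d.2)) p'.1 r (h * d.1) => //.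
  move=> k kr; have [] // := Cf (p'.1 + k) (p'.2 + h * d.2).
  by apply: H1; [case: (rr _ kr)|case: (rr _ h2)].
have [||k2 k2h E2] := @mvt_ball R (fun s => f (p'.1, s))
  (fun s => fy (p'.1, s)) p'.2 r (h * d.2) => //.
  move=> k kr; have [] // := Cf p'.1 (p'.2 + k).
  by have := H1 0 k; rewrite addr0 normr0; apply => //; case: (rr _ kr).
have Ep : f p' = f (p'.1, p'.2) by case: (p').
have -> : f (p'.1 + h * d.1, p'.2 + h * d.2) - f p' -
    (d.1 * fx p' + d.2 * fy p') * h =
  ((fx (p'.1 + k1, p'.2 + h * d.2) - fx p') * d.1 +
   (fy (p'.1, p'.2 + k2) - fy p') * d.2) * h.
  rewrite Ep.
  have -> : f (p'.1 + h * d.1, p'.2 + h * d.2) - f (p'.1, p'.2) =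
    (f (p'.1 + h * d.1, p'.2 + h * d.2) - f (p'.1, p'.2 + h * d.2)) +
    (f (p'.1, p'.2 + h * d.2) - f (p'.1, p'.2)) by ring.
  by rewrite E1 E2; ring.
rewrite normrM ler_wpM2r //.
have b1 : `|fx (p'.1 + k1, p'.2 + h * d.2) - fx p'| <= e / M.
  apply/ltW/H2; last by case: (rr _ h2).
  by case: (rr k1) => //; exact: le_lt_trans h1.
have b2 : `|fy (p'.1, p'.2 + k2) - fy p'| <= e / M.
  have := H3 0 k2; rewrite addr0 normr0 => H; apply/ltW/H => //.
  by case: (rr k2) => //; exact: le_lt_trans h2.
apply: (le_trans (ler_normD _ _)); rewrite !normrM.
apply: (le_trans (lerD (ler_wpM2r (normr_ge0 _) b1) (ler_wpM2r (normr_ge0 _) b2))).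
rewrite -mulrDr mulrAC ler_pdivrMr //; apply: ler_wpM2l; first exact: ltW.
by rewrite /M lerDl.
Qed.

(** Schwarz's argument: the mixed second difference of [u] over a small square is computed by the
    mean value theorem in either order, so a value of [uxy] and one of [uyx] near [p] coincide;
    continuity then excludes a gap at [p]. *)
Lemma second_partials_comm D u ux uy uxx uxy uyx uyy p : open D ->
  C1_partials D u ux uy -> C1_partials D ux uxx uxy -> C1_partials D uy uyx uyy ->
  D p -> uxy p = uyx p.
Proof.
case: p => x y oD Cu Cx Cy Dp; apply/eqP/negPn/negP => neq.
pose e := `|uxy (x, y) - uyx (x, y)| / 2.
have e0 : 0 < e by rewrite divr_gt0 // normr_gt0 subr_eq0.
have [_ _ _ cxy] := Cx _ _ Dp.
have [_ _ cyx _] := Cy _ _ Dp.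
have [r1 r10 H1] := open_planeP oD Dp.
have [r2 r20 H2] := (continuous_planeP _ _).1 cxy _ e0.
have [r3 r30 H3] := (continuous_planeP _ _).1 cyx _ e0.
rewrite /= in H1 H2 H3.
pose r := Num.min r1 (Num.min r2 r3).
have r0 : 0 < r by rewrite !lt_min r10 r20.
have rr (a : R) : `|a| < r -> [/\ `|a| < r1, `|a| < r2 & `|a| < r3].
  by rewrite !lt_min => /and3P[].
pose h := r / 2.
have h0 : 0 < h by rewrite /h; lra.
have hr : `|h| < r by rewrite gtr0_norm // /h; lra.
have Dh (a b : R) : `|a| < r -> `|b| < r -> D (x + a, y + b).
  by move=> /rr[? _ _] /rr[? _ _]; exact: H1.
have D1 (a : R) : `|a| < r -> D (x + a, y).
  by move=> ar; have := Dh a 0; rewrite addr0 normr0; exact.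
have D2 (a : R) : `|a| < r -> D (x, y + a).
  by move=> ar; have := Dh 0 a; rewrite addr0 normr0; exact.
have [k kr|k1 k1h E1] := @mvt_ball R (fun s => u (s, y + h) - u (s, y))
  (fun s => ux (s, y + h) - ux (s, y)) x r h _ hr.
  have [H _ _ _] := Cu _ _ (Dh k h kr hr).
  have [H' _ _ _] := Cu _ _ (D1 k kr).
  exact: is_deriveB.
have k1r := le_lt_trans k1h hr.
have [k kr|k2 k2h E2] := @mvt_ball R (fun s => ux (x + k1, s))
  (fun s => uxy (x + k1, s)) y r h _ hr.
  by have [] := Cx _ _ (Dh k1 k k1r kr).
have [k kr|k3 k3h E3] := @mvt_ball R (fun s => u (x + h, s) - u (x, s))
  (fun s => uy (x + h, s) - uy (x, s)) y r h _ hr.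
  have [_ H _ _] := Cu _ _ (Dh h k hr kr).
  have [_ H' _ _] := Cu _ _ (D2 k kr).
  exact: is_deriveB.
have k3r := le_lt_trans k3h hr.
have [k kr|k4 k4h E4] := @mvt_ball R (fun s => uy (s, y + k3))
  (fun s => uyx (s, y + k3)) x r h _ hr.
  by have [] := Cy _ _ (Dh k k3 kr k3r).
have k2r := le_lt_trans k2h hr.
have k4r := le_lt_trans k4h hr.
have eq12 : uxy (x + k1, y + k2) = uyx (x + k4, y + k3).
  rewrite /= in E1 E2 E3 E4.
  have hh : h * h != 0 by rewrite mulf_neq0 // gt_eqF.
  apply: (mulIf hh).
  have -> : uxy (x + k1, y + k2) * (h * h) = uxy (x + k1, y + k2) * h * h by ring.
  have -> : uyx (x + k4, y + k3) * (h * h) = uyx (x + k4, y + k3) * h * h by ring.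
  by rewrite -E2 -E4 -E1 -E3; ring.
have [_ a1 _] := rr _ k1r; have [_ a2 _] := rr _ k2r.
have [_ _ a3] := rr _ k3r; have [_ _ a4] := rr _ k4r.
have := H2 k1 k2 a1 a2; have := H3 k4 k3 a4 a3; rewrite eq12.
set A := uyx (_ + _, _); set B := uyx _; set C := uxy _ => HA HB.
have : `|C - B| < `|C - B|.
  have e2 : `|C - B| = e + e by rewrite /e -splitr.
  rewrite {2}e2.
  have -> : C - B = - (A - C) + (A - B) by ring.
  by apply: le_lt_trans (ler_normD _ _) _; rewrite normrN ltrD.
by rewrite ltxx.
Qed.

Lemma is_derive_line2 D u ux uy uxx uxy uyx uyy p d (t : R) : open D ->
  C1_partials D u ux uy -> C1_partials D ux uxx uxy -> C1_partials D uy uyx uyy ->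
  D (line p d t) ->
  is_derive t 1 (fun s => d.1 * ux (line p d s) + d.2 * uy (line p d s))
    (d.1 ^+ 2 * uxx (line p d t) + 2 * (d.1 * d.2) * uxy (line p d t) +
     d.2 ^+ 2 * uyy (line p d t)).
Proof.
move=> oD Cu Cx Cy Dp.
have H1 := is_derive_line oD Cx Dp; have H2 := is_derive_line oD Cy Dp.
have := is_deriveD (is_deriveZ d.1 H1) (is_deriveZ d.2 H2).
move/is_derive_eq; apply; rewrite -(second_partials_comm oD Cu Cx Cy Dp).
by rewrite /GRing.scale /=; ring.
Qed.

Lemma near_line (P : R * R -> Prop) p d : (\forall q \near p, P q) ->
  \forall t \near (0 : R), P (line p d t).
Proof.
move=> /near_planeP[e e0 H].
pose M : R := `|d.1| + `|d.2| + 1.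
have M0 : 0 < M by rewrite /M; have := normr_ge0 d.1; have := normr_ge0 d.2; lra.
apply/near0P; exists (e / M); first by rewrite divr_gt0.
move=> t; rewrite add0r ltr_pdivlMr // => tM.
apply: H; apply: le_lt_trans tM; rewrite normrM ler_wpM2l // /M.
  by have := normr_ge0 d.2; lra.
by have := normr_ge0 d.1; lra.
Qed.

(** If [u q] were below the tangent plane, convexity would keep [u] under a chord whose slope is
    less than the directional derivative [l] at [p]. *)
Lemma convex_above_tangent D u ux uy p q : open D -> C1_partials D u ux uy -> convex_fun_on D u ->
  D p -> D q ->
  u p + (q.1 - p.1) * ux p + (q.2 - p.2) * uy p <= u q.
Proof.
move=> oD Cu cu Dp Dq.
pose d : R * R := (q.1 - p.1, q.2 - p.2).
have Dl : D (line p d 0) by rewrite line0.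
have := is_derive_line oD Cu Dl; rewrite line0 /=.
set l := _ + _ => dl.
rewrite -addrA -/l leNgt; apply/negP => lt.
have [|r r0 Hr] := derive_epsP dl (e := (u p + l - u q) / 2).
  by rewrite divr_gt0 // subr_gt0.
pose h := Num.min r 1 / 2.
have m0 : 0 < Num.min r 1 by rewrite lt_min r0 ltr01.
have [m1 m2] : Num.min r 1 <= r /\ Num.min r 1 <= 1.
  by split; rewrite ge_min lexx ?orbT.
have h0 : 0 < h by rewrite /h; lra.
have := Hr h; rewrite gtr0_norm // => /(_ _)/ler_normlP[|+ _]; first by rewrite /h; lra.
rewrite add0r line0.
have -> : line p d h = convex_comb h q p.
  by rewrite /line /convex_comb /d /=; congr (_, _); ring.
have := cu q p h Dq Dp; have -> : 0 <= h <= 1 by rewrite /h; apply/andP; split; lra.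
move=> /(_ isT).
nra.
Qed.

(** Adding the tangent inequalities at two points of a horizontal line shows that [ux] does not
    decrease along it. *)
Lemma convex_uxx_ge0 D u ux uy uxx uxy p : open D ->
  C1_partials D u ux uy -> C1_partials D ux uxx uxy -> convex_fun_on D u -> D p ->
  0 <= uxx p.
Proof.
move=> oD Cu Cx cu Dp; rewrite leNgt; apply/negP => lt.
case: p Dp lt => x y Dp lt.
have [dx _ _ _] := Cx _ _ Dp.
have [|r r0 Hr] := derive_epsP dx (e := - uxx (x, y) / 2).
  by rewrite divr_gt0 // oppr_gt0.
have [e e0 He] := open_planeP oD Dp.
pose h := Num.min r e / 2.
have m0 : 0 < Num.min r e by rewrite lt_min r0.
have [m1 m2] : Num.min r e <= r /\ Num.min r e <= e.
  by split; rewrite ge_min lexx ?orbT.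
have h0 : 0 < h by rewrite /h; lra.
have [hr he] : h < r /\ h < e by rewrite /h; split; lra.
have Dh : D (x + h, y).
  by have := He h 0; rewrite addr0 normr0; apply => //; rewrite gtr0_norm.
have := Hr h; rewrite gtr0_norm // => /(_ hr)/ler_normlP[_ +].
have := convex_above_tangent oD Cu cu Dp Dh.
have := convex_above_tangent oD Cu cu Dh Dp.
rewrite /= !subrr !mul0r !addr0.
have -> : x + h - x = h by ring.
have -> : x - (x + h) = - h by ring.
move: (ux (x, y)) (ux (x + h, y)) (uxx _) lt => a b c lt H1 H2 H3.
have ab : a <= b by rewrite -(ler_pM2l h0); move: H1 H2; clear; lra.
move: ab H3 lt h0; clear; nra.
Qed.

End Plane.

(** * Quadratic forms, compactness and the geometry of the domain *)

Section Geometry.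
Variable R : realType.
Implicit Types (D : set (R * R)) (p q b : R * R).

Lemma psd_disc (al be ga : R) :
  (forall x y : R, 0 <= al * x ^+ 2 + 2 * be * (x * y) + ga * y ^+ 2) ->
  [/\ 0 <= al, 0 <= ga & be ^+ 2 <= al * ga].
Proof.
move=> H.
have al0 : 0 <= al by have := H 1 0; lra.
have ga0 : 0 <= ga by have := H 0 1; lra.
split => //.
have [g0|g0] := eqVneq ga 0.
  have -> : be = 0; last by rewrite expr0n /= mulr_ge0.
  apply/eqP; rewrite -sqrf_eq0 eq_le sqr_ge0 andbT.
  (* With [ga = 0] the form takes the value [- be ^+ 2] at this vector. *)
  have := H be (- (al + 1) / 2); rewrite g0.
  have -> : al * be ^+ 2 + 2 * be * (be * (- (al + 1) / 2)) +
    0 * (- (al + 1) / 2) ^+ 2 = - be ^+ 2 by field.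
  by rewrite oppr_ge0.
have gp : 0 < ga by rewrite lt_neqAle eq_sym g0.
rewrite -subr_ge0 -(pmulr_rge0 _ gp).
have := H ga (- be); congr (0 <= _); ring.
Qed.

(** Write the large form as [k] times the small one plus a semidefinite remainder [(al, be, ga)]. In
    the expansion of the determinant the mixed term and the determinant of the remainder are
    nonnegative, and [k ^+ 2 > 1] gives strictness. *)
Lemma hessian_comparison (k a b c a' b' c' : R) : 1 < k -> 0 <= a' ->
  0 < a' * c' - b' ^+ 2 ->
  (forall x y : R, k * (a' * x ^+ 2 + 2 * b' * (x * y) + c' * y ^+ 2) <=
     a * x ^+ 2 + 2 * b * (x * y) + c * y ^+ 2) ->
  a' * c' - b' ^+ 2 < a * c - b ^+ 2.
Proof.
move=> k1 a0 det H.
have [|al0 ga0 disc] := @psd_disc (a - k * a') (b - k * b') (c - k * c').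
  move=> x y; have := H x y; rewrite -subr_ge0; congr (0 <= _); ring.
have ac0 : 0 < a' * c' by apply: lt_le_trans det _; rewrite gerBl sqr_ge0.
have ap : 0 < a'.
  by rewrite lt_neqAle a0 andbT; apply: contraTneq ac0 => <-; rewrite mul0r ltxx.
have cp : 0 < c' by rewrite -(pmulr_rgt0 _ ap).
set al := a - k * a' in al0 disc; set be := b - k * b' in disc.
set ga := c - k * c' in ga0 disc.
(* The mixed discriminant of two semidefinite forms is nonnegative: [b' * be] is at most the
   geometric mean of [a' * ga] and [c' * al]. *)
have cross : 2 * (b' * be) <= a' * ga + c' * al.
  have s0 : 0 <= a' * ga + c' * al by rewrite addr_ge0 // mulr_ge0 // ltW.
  rewrite (le_trans (ler_norm _)) // -(ger0_norm s0) -ler_sqr ?nnegrE //.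
  rewrite !real_normK ?num_real //.
  have h1 : (b' * be) ^+ 2 <= (a' * c') * (al * ga).
    rewrite exprMn; apply: ler_pM; rewrite ?sqr_ge0 //.
    by rewrite ltW // -subr_gt0.
  have h2 : 0 <= (a' * ga - c' * al) ^+ 2 by rewrite sqr_ge0.
  move: h1 h2; clear; lra.
have -> : a * c - b ^+ 2 = k ^+ 2 * (a' * c' - b' ^+ 2) +
    k * (a' * ga + c' * al - 2 * (b' * be)) + (al * ga - be ^+ 2).
  by rewrite /al /be /ga; ring.
have t1 : 0 <= k * (a' * ga + c' * al - 2 * (b' * be)).
  by rewrite mulr_ge0 ?subr_ge0 //; lra.
have t2 : 0 <= al * ga - be ^+ 2 by rewrite subr_ge0.
have t3 : a' * c' - b' ^+ 2 < k ^+ 2 * (a' * c' - b' ^+ 2).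
  by rewrite ltr_pMl // expr_gt1 //; lra.
by move: t1 t2 t3; clear; lra.
Qed.

Lemma closure_planeP D p : closure D p <->
  forall e : R, 0 < e -> exists2 q, D q & `|q.1 - p.1| < e /\ `|q.2 - p.2| < e.
Proof.
split=> [cp e e0|H B /near_planeP[e e0 He]].
  have [|q [Dq [q1 q2]]] := cp [set q | `|q.1 - p.1| < e /\ `|q.2 - p.2| < e].
    apply: (near_planeP _ _).2; exists e => // a b ae be /=.
    by rewrite !(addrC _ a) !(addrC _ b) !addrK.
  by exists q.
have [q Dq [q1 q2]] := H e e0.
exists q; split => //.
have := He _ _ q1 q2; rewrite !subrKC; by case: (q).
Qed.

Lemma enorm_le (v : R * R) : enorm v <= `|v.1| + `|v.2|.
Proof.
rewrite /enorm -(ger0_norm (addr_ge0 (normr_ge0 v.1) (normr_ge0 v.2))) -sqrtr_sqr.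
rewrite ler_wsqrtr // sqrrD !real_normK ?num_real //.
by rewrite addrAC lerDl mulrn_wge0 // mulr_ge0.
Qed.

(** A tube lemma, from the covering form of compactness; it turns the pointwise continuity arguments
    below into one admissible range for the scaling parameter. *)
Lemma compact_uniform (A : set (R * R)) (P : R -> R * R -> Prop) (s0 : R) :
  compact A ->
  (forall b, A b -> exists2 e : R, 0 < e & forall (b' : R * R) (s : R), A b' ->
     `|b'.1 - b.1| < e -> `|b'.2 - b.2| < e -> `|s - s0| < e -> P s b') ->
  exists2 e : R, 0 < e & forall s, `|s - s0| < e -> forall b, A b -> P s b.
Proof.
move=> /compact_near_coveringP/near_covering_withinP cA H.
have /near0P[e e0 He] : \forall s \near s0, A `<=` P s.
  apply: (cA _ (nbhs s0) P _) => b Ab; have [e e0 He] := H b Ab.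
  exists ([set b' : R * R | `|b'.1 - b.1| < e /\ `|b'.2 - b.2| < e],
          [set s : R | `|s - s0| < e]) => /=.
    split.
      apply: (near_planeP _ _).2; exists e => // x y xe ye /=.
      by rewrite !(addrC _ x) !(addrC _ y) !addrK.
    by apply: (near0P _ _).2; exists e => // h he; rewrite /= addrAC subrr add0r.
  by move=> [b' s] /= [[b1 b2] s1] Ab'; exact: He.
exists e => // s se b Ab.
have -> : s = s0 + (s - s0) by ring.
exact: He.
Qed.

Definition scale_pt (t : R) p : R * R := (t * p.1, t * p.2).

Section Domain.
Variable D : set (R * R).
Hypothesis oD : open D.
Hypothesis scD : strictly_convex_set D.
Hypothesis aD : axially_symmetric D.
Hypothesis D0 : D (0, 0).
Hypothesis Dbd : D `<=` square (4 / 3).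

Lemma closure_flip (x y : R) : closure D (x, y) -> closure D (x, - y).
Proof.
move=> /closure_planeP H; apply/closure_planeP => e e0.
have [[a b] Dab [/= h1 h2]] := H e e0.
exists (a, - b); first by case: (aD Dab).
by split => //=; rewrite opprK addrC -normrN opprD opprK addrC.
Qed.

(** The point lies strictly between [(x, y)] and its mirror image in the x-axis, and strict
    convexity applies up to the closure. *)
Lemma vertical_segment (x y y' : R) : closure D (x, y) -> y < y' < - y -> D (x, y').
Proof.
move=> cD /andP[y1 y2].
have yn : y < 0 by lra.
have tn : 0 < (y' + y) / (2 * y) < 1.
  have -> : (y' + y) / (2 * y) = (- y' - y) / (- 2 * y) by field; lra.
  apply/andP; split; first by rewrite divr_gt0; lra.
  by rewrite ltr_pdivrMr; lra.
have neq : (x, y) <> (x, - y) by case; lra.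
have := scD cD (closure_flip cD) neq tn.
rewrite /convex_comb /=; congr (D (_, _)); first by ring.
by field; lra.
Qed.

(** Strict convexity applied to [p] and the origin, which lies in [D]: shrinking pulls even boundary
    points inside. *)
Lemma scale_closure (t : R) p : closure D p -> 0 <= t < 1 -> D (scale_pt t p).
Proof.
move=> cp /andP[t0 t1].
have [->|tn] := eqVneq t 0; first by rewrite /scale_pt !mul0r.
have [->|p0] := eqVneq p (0, 0); first by rewrite /scale_pt !mulr0.
have tt : 0 < t < 1 by rewrite lt_neqAle eq_sym tn t0.
have := scD cp (subset_closure D0) (elimN eqP p0) tt.
by rewrite /convex_comb /scale_pt /= !mulr0 !addr0.
Qed.

Lemma closure_compact : compact (closure D).
Proof.
have cS : compact (`[- (4 / 3) : R, 4 / 3] `*` `[- (4 / 3) : R, 4 / 3]).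
  by apply: compact_setX; exact: segment_compact.
apply: (subclosed_compact _ cS); first exact: closed_closure.
have -> : `[- (4 / 3) : R, 4 / 3] `*` `[- (4 / 3) : R, 4 / 3] =
  closure (`[- (4 / 3) : R, 4 / 3] `*` `[- (4 / 3) : R, 4 / 3]).
  by apply/closure_id; apply: (compact_closed (@norm_hausdorff _ _)) cS.
apply: closure_subset => p /Dbd [p1 p2]; split; by rewrite /= in_itv.
Qed.

Lemma below_compact (l : R) : compact (closure D `&` [set p | p.2 <= l]).
Proof.
apply: (compact_closedI closure_compact).
have -> : [set p : R * R | p.2 <= l] = snd @^-1` [set x : R | x <= l] by [].
by apply: closed_comp => // x _; exact: cvg_snd.
Qed.

Lemma boundary_below_compact (l : R) : compact (boundary D `&` [set p | p.2 <= l]).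
Proof.
have -> : boundary D `&` [set p | p.2 <= l] =
  (closure D `&` [set p | p.2 <= l]) `&` ~` D.
  by rewrite /boundary setIAC.
apply: (compact_closedI (@below_compact l)).
exact: open_closedC.
Qed.

End Domain.
End Geometry.

(** * Reflection in a horizontal line *)

Section BoundaryGradient.
Variable R : realType.
Implicit Types (p q b : R * R) (D : set (R * R)) (u ux uy : R * R -> R).

Definition gradient_blowup (D : set (R * R)) (ux uy : R * R -> R) : Prop :=
  forall b, boundary D b -> forall M : R, exists2 d : R, 0 < d &
  forall x, D x -> enorm (x.1 - b.1, x.2 - b.2) < d -> M < enorm (ux x, uy x).

(* Near [b] the gradient is large, while convexity at the points
   [(b.1 +- rho, 0)] of [D] bounds [rho / 2 * |ux| - p.2 * uy] from above. *)
Lemma uy_boundary D u ux uy b (M : R) : open D -> strictly_convex_set D ->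
  axially_symmetric D -> C1_partials D u ux uy -> convex_fun_on D u ->
  gradient_blowup D ux uy -> boundary D b -> b.2 < 0 ->
  exists2 e : R, 0 < e & forall p, D p ->
    `|p.1 - b.1| < e -> `|p.2 - b.2| < e -> uy p < - M.
Proof.
move=> oD scD aD Cu convex_u blowup bb b2; have [cb nDb] := bb.
have Dc : D (b.1, 0).
  by apply: (vertical_segment scD aD (y := b.2)); [case: (b) cb|lra].
have [r r0 Hr] := open_planeP oD Dc.
pose rho := r / 2.
have rho0 : 0 < rho by rewrite /rho; lra.
have Dq (s : R) : `|s| < r -> D (b.1 + s, 0).
  by move=> sr; have := Hr s 0; rewrite /= addr0 normr0; apply.
have Dp : D (b.1 + rho, 0) by apply: Dq; rewrite gtr0_norm // /rho; lra.
have Dm : D (b.1 - rho, 0) by apply: Dq; rewrite normrN gtr0_norm // /rho; lra.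
pose S : R := `|u (b.1 + rho, 0)| + `|u (b.1 - rho, 0)| + `|u (b.1, 0)| +
  `|ux (b.1, 0)| + `|uy (b.1, 0)| * (`|b.2| + 1).
(* [N] is the sum of the bounds on [|ux p|] and [|uy p|] that follow below if [uy p >= - M]; the
   blow-up then contradicts this assumption. *)
pose N : R := (S + (`|b.2| + 1) * `|M|) * (2 / rho) + 2 * S / `|b.2| + `|M|.
have [d d0 Hd] := blowup _ bb N.
pose e : R := Num.min (d / 2) (Num.min 1 (Num.min (rho / 2) (- b.2 / 2))).
have e0 : 0 < e by rewrite /e !lt_min ltr01; apply/and3P; split=> //; [lra|apply/andP; split; lra].
exists e => // p Dp' p1 p2.
move: (p1) (p2); rewrite /e !lt_min => /and4P[p1d p11 p1r p1b] /and4P[p2d p21 p2r p2b].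
have NB : N < `|ux p| + `|uy p|.
  apply: lt_le_trans (Hd p Dp' _) (enorm_le _).
  by apply: le_lt_trans (enorm_le _) _ => /=; lra.
have tc := convex_above_tangent oD Cu convex_u Dc Dp'.
have tp := convex_above_tangent oD Cu convex_u Dp' Dp.
have tm := convex_above_tangent oD Cu convex_u Dp' Dm.
rewrite /= in tc tp tm.
rewrite ltNge; apply/negP => uyM.
have b2n : `|b.2| = - b.2 by rewrite ltr0_norm.
have [B1 B2] : - `|b.2| - 1 <= p.2 /\ p.2 <= - `|b.2| / 2.
  move: p21 p2b; rewrite b2n !ltr_norml => /andP[h1 _] /andP[_ h2].
  by move: h1 h2; clear; split; lra.
(* The tangent plane at [(b.1, 0)] bounds [u p] from below, uniformly for [p] near [b]. *)
have lowc : - (`|u (b.1, 0)| + `|ux (b.1, 0)| + `|uy (b.1, 0)| * (`|b.2| + 1)) <= u p.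
  have h1 : - `|ux (b.1, 0)| <= (p.1 - b.1) * ux (b.1, 0).
    rewrite lerNl -mulNr; apply: le_trans (ler_norm _) _.
    by rewrite normrM normrN ler_piMl // ltW.
  have h2 : - (`|uy (b.1, 0)| * (`|b.2| + 1)) <= (p.2 - 0) * uy (b.1, 0).
    rewrite lerNl -mulNr; apply: le_trans (ler_norm _) _.
    rewrite normrM normrN mulrC ler_wpM2l // subr0 ler_norml.
    by apply/andP; split; move: B1 B2 (normr_ge0 b.2); clear; lra.
  have h3 : - `|u (b.1, 0)| <= u (b.1, 0) by rewrite lerNl -normrN ler_norm.
  by move: tc h1 h2 h3; clear; lra.
(* The tangent inequality at [p] is tested at the right or the left point according to the sign of
   [ux p]; both are at horizontal distance at least [rho / 2] from [p]. *)
have key : rho / 2 * `|ux p| + - p.2 * uy p <= S.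
  have hp := ler_norm (u (b.1 + rho, 0)).
  have hm := ler_norm (u (b.1 - rho, 0)).
  have hp0 := normr_ge0 (u (b.1 + rho, 0)).
  have hm0 := normr_ge0 (u (b.1 - rho, 0)).
  move: p1r; rewrite ltr_norml => /andP[r1 r2].
  have [g0|g0] := leP 0 (ux p).
    have : rho / 2 * ux p <= (b.1 + rho - p.1) * ux p by apply: ler_wpM2r => //; move: r2; clear; lra.
    by rewrite /S (ger0_norm g0); move: lowc tp hp hm0; clear; lra.
  have : rho / 2 * (- ux p) <= (p.1 - b.1 + rho) * (- ux p) by apply: ler_wpM2r; move: r1 g0; clear; lra.
  by rewrite /S (ltr0_norm g0); move: lowc tm hm hp0; clear; lra.
have S0 : 0 <= S.
  by rewrite /S !addr_ge0 // mulr_ge0 // addr_ge0.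
have Mle := ler_norm M.
have bx : rho / 2 * `|ux p| <= S + (`|b.2| + 1) * `|M|.
  have : - ((`|b.2| + 1) * `|M|) <= - p.2 * uy p.
    have [g0|g0] := leP 0 (uy p).
      apply: (@le_trans _ _ 0); first by rewrite oppr_le0 mulr_ge0 // addr_ge0.
      by apply: mulr_ge0 => //; move: B2 (normr_ge0 b.2); clear; lra.
    rewrite -(opprK (- p.2 * uy p)) lerN2 -mulrN.
    apply: ler_pM; last by move: Mle uyM; clear; lra.
    - by move: B2 (normr_ge0 b.2); clear; lra.
    - by move: g0; clear; lra.
    - by move: B1; clear; lra.
  by move: key; clear; lra.
have bx' : `|ux p| <= (S + (`|b.2| + 1) * `|M|) * (2 / rho).
  rewrite -ler_pdivrMr ?divr_gt0 // invf_div mulrC; exact: bx.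
have b20 : 0 < `|b.2| by rewrite b2n oppr_gt0.
have Sb : 0 <= 2 * S / `|b.2| by rewrite divr_ge0 // mulr_ge0.
have by' : `|uy p| <= 2 * S / `|b.2| + `|M|.
  have [g0|g0] := leP 0 (uy p); last by rewrite ltr0_norm //; move: Sb uyM Mle; clear; lra.
  have : uy p <= 2 * S / `|b.2|.
    rewrite ler_pdivlMr //.
    have h1 : `|b.2| / 2 * uy p <= - p.2 * uy p.
      by apply: ler_wpM2r => //; move: B2; clear; lra.
    have h2 : 0 <= rho / 2 * `|ux p| by rewrite mulr_ge0 // divr_ge0 // ltW.
    by move: key h1 h2; clear; lra.
  by rewrite (ger0_norm g0); move: (normr_ge0 M); clear; lra.
by move: NB bx' by'; rewrite /N; clear; lra.
Qed.

(* On the part of the boundary with [b.2 = l] both points tend to [b]; on the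
   rest the reflected point stays in a compact subset of [D]. *)
Lemma reflected_sum_lt0 D u ux uy (l : R) b : open D -> strictly_convex_set D ->
  axially_symmetric D -> C1_partials D u ux uy -> convex_fun_on D u ->
  gradient_blowup D ux uy -> (forall p, D p -> {for p, continuous uy}) -> l < 0 -> boundary D b -> b.2 <= l ->
  exists2 e : R, 0 < e & forall p q, D p -> D q ->
    `|p.1 - b.1| < e -> `|p.2 - b.2| < e ->
    `|q.1 - b.1| < e -> `|q.2 - (2 * l - b.2)| < e -> uy p + uy q < 0.
Proof.
move=> oD scD aD Cu cu bu cont_uy l0 bb; rewrite le_eqVlt => /predU1P[bl|bl].
  have [|e e0 He] := @uy_boundary D u ux uy b 0 oD scD aD Cu cu bu bb; first by rewrite bl.
  exists e => // p q Dp Dq p1 p2 q1; rewrite bl => q2.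
  have := He p Dp p1 p2; have := He q Dq q1.
  have -> : q.2 - b.2 = q.2 - (2 * l - l) by rewrite bl; ring.
  by move=> /(_ q2); lra.
have Dr : D (b.1, 2 * l - b.2).
  apply: (vertical_segment scD aD (y := b.2)); last by lra.
  by case: bb; case: (b).
have [r r0 Hr] := (continuous_planeP _ _).1 (cont_uy _ Dr) 1 ltr01.
have [|e e0 He] := @uy_boundary D u ux uy b (uy (b.1, 2 * l - b.2) + 1) oD scD aD Cu cu bu bb; first by lra.
exists (Num.min e r); first by rewrite lt_min e0.
move=> p q Dp Dq; rewrite !lt_min => /andP[p1 _] /andP[p2 _] /andP[_ q1] /andP[_ q2].
have := He p Dp p1 p2; have := Hr _ _ q1 q2.
rewrite /= !subrKC -surjective_pairing => /ltr_normlP[_ h1] h2.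
by lra.
Qed.

End BoundaryGradient.

Section Reflection.
Variable R : realType.
Implicit Types (p q b d : R * R) (D : set (R * R)) (u ux uy : R * R -> R).

Definition flip (l : R) b : R * R := (b.1, 2 * l - b.2).

Lemma flip_in D (l : R) b : strictly_convex_set D -> axially_symmetric D ->
  l < 0 -> D b -> b.2 <= l -> D (flip l b).
Proof.
move=> scD aD l0 Db; rewrite le_eqVlt => /predU1P[bl|bl].
  have -> : flip l b = b; last by [].
  by case: b bl Db => x y /= -> _; rewrite /flip /=; congr (_, _); ring.
apply: (vertical_segment scD aD (y := b.2)); last by lra.
by rewrite -surjective_pairing; exact: subset_closure.
Qed.

Lemma flip_closure D (l : R) b : strictly_convex_set D -> axially_symmetric D ->
  l < 0 -> closure D b -> b.2 <= l -> closure D (flip l b).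
Proof.
move=> scD aD l0 Db; rewrite le_eqVlt => /predU1P[bl|bl].
  have -> : flip l b = b; last by [].
  by case: b bl Db => x y /= -> _; rewrite /flip /=; congr (_, _); ring.
apply/subset_closure/(vertical_segment scD aD (y := b.2)); last by lra.
by rewrite -surjective_pairing.
Qed.

Lemma scale_near (x r : R) : 0 < r -> exists2 e : R, 0 < e & forall x' s : R,
  0 < s < 1 -> `|x' - x| < e -> `|s - 1| < e -> `|s * x' - x| < r.
Proof.
move=> r0; have x1 : 0 < 1 + `|x| by rewrite ltr_pwDl.
pose e := r / (1 + `|x|).
have e0 : 0 < e by rewrite divr_gt0.
exists e => // x' s /andP[s0 s1] xx ss.
have -> : s * x' - x = s * (x' - x) + (s - 1) * x by ring.
apply: le_lt_trans (ler_normD _ _) _; rewrite !normrM (gtr0_norm s0).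
have -> : r = e * 1 + e * `|x| by rewrite -mulrDr /e divfK // gt_eqF.
apply: ltr_leD; last by rewrite ler_wpM2r // ltW.
rewrite mulr1; apply: le_lt_trans xx; rewrite ler_piMl //; exact: ltW.
Qed.

Lemma unscale_near (rho x r : R) : 0 < rho -> 0 < r ->
  exists2 e : R, 0 < e & forall x' s : R, `|x' - x| < e -> `|s - 1| < e ->
    `|rho / s * x' - rho * x| < r.
Proof.
move=> rho0 r0; have x1 : 0 < 1 + `|x| by rewrite ltr_pwDl.
pose f := r / (2 * rho * (1 + `|x|)).
have f0 : 0 < f by rewrite divr_gt0 // !mulr_gt0.
exists (Num.min (1 / 2) f); first by rewrite lt_min f0 andbT; lra.
move=> x' s; rewrite !lt_min => /andP[_ xx] /andP[/ltr_normlP[s1 s2] ss].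
have s0 : 1 / 2 < s by lra.
have sp : 0 < s by lra.
have -> : rho / s * x' - rho * x = rho / s * ((x' - x) + (1 - s) * x).
  by field; rewrite gt_eqF.
rewrite normrM gtr0_norm ?divr_gt0 //.
have rs : rho / s <= 2 * rho.
  by rewrite ler_pdivrMr // mulrAC mulrC ler_pMr // ; lra.
have h : `|(x' - x) + (1 - s) * x| < f * (1 + `|x|).
  apply: le_lt_trans (ler_normD _ _) _; rewrite mulrDr mulr1 normrM distrC in xx *.
  by rewrite (distrC 1); apply: ltr_leD => //; rewrite ler_wpM2r // ltW.
have -> : r = 2 * rho * (f * (1 + `|x|)).
  by rewrite /f; field; rewrite !gt_eqF.
apply: (@le_lt_trans _ _ (2 * rho * `|(x' - x) + (1 - s) * x|)).
  by rewrite ler_wpM2r.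
by rewrite ltr_pM2l // mulr_gt0.
Qed.

Lemma continuous_scale (f : R * R -> R) (rho : R) q : 0 < rho ->
  {for scale_pt rho q, continuous f} -> forall eps : R, 0 < eps ->
  exists2 e : R, 0 < e & forall q' (s : R), `|q'.1 - q.1| < e ->
    `|q'.2 - q.2| < e -> `|s - 1| < e ->
    `|f (scale_pt (rho / s) q') - f (scale_pt rho q)| < eps.
Proof.
move=> rho0 cf eps eps0.
have [r r0 Hr] := (continuous_planeP _ _).1 cf eps eps0.
have [e1 e10 H1] := unscale_near q.1 rho0 r0.
have [e2 e20 H2] := unscale_near q.2 rho0 r0.
exists (Num.min e1 e2); first by rewrite lt_min e10.
move=> q' s; rewrite !lt_min => /andP[q1 _] /andP[_ q2] /andP[s1 s2].
have := Hr _ _ (H1 _ _ q1 s1) (H2 _ _ q2 s2).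
by rewrite /= !subrKC.
Qed.

(** For [rho < s < 1] both arguments of [u] lie in the open domain even for [b] in the closed cap.
    The factor [s] cancels [1 / s] in the first derivatives of the reflected term and leaves a
    factor [1 / s] in its second derivatives. *)
Definition flip_diff u (rho s l : R) b : R :=
  u (scale_pt rho b) - s * u (scale_pt (rho / s) (flip l b)).

Lemma continuous_flip_diff D u (rho s l : R) b :
  (forall p, D p -> {for p, continuous u}) -> 0 < rho -> 0 < s < 1 ->
  D (scale_pt rho b) -> D (scale_pt (rho / s) (flip l b)) ->
  {for b, continuous (flip_diff u rho s l)}.
Proof.
move=> cu rho0 /andP[s0 s1] D1 D2; apply/continuous_planeP => e e0.
have rs0 : 0 < rho / s by rewrite divr_gt0.
have e2 : 0 < e / 2 by rewrite divr_gt0.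
have [r1 r10 H1] := continuous_scale rho0 (cu _ D1) e2.
have [r2 r20 H2] := continuous_scale rs0 (cu _ D2) e2.
exists (Num.min r1 r2); first by rewrite lt_min r10.
move=> x y; rewrite !lt_min => /andP[x1 x2] /andP[y1 y2].
have := H1 (b.1 + x, b.2 + y) 1; rewrite /= subrr normr0 divr1.
have -> : b.1 + x - b.1 = x by ring.
have -> : b.2 + y - b.2 = y by ring.
move=> /(_ x1 y1 r10) h1.
have := H2 (flip l (b.1 + x, b.2 + y)) 1; rewrite /= subrr normr0 divr1.
have -> : b.1 + x - b.1 = x by ring.
have -> : 2 * l - (b.2 + y) - (2 * l - b.2) = - y by ring.
rewrite normrN => /(_ x2 y2 r20) h2.
rewrite /flip_diff.
set A := u (scale_pt rho (_, _)) in h1 *; set B := u (scale_pt rho b) in h1 *.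
set A' := u (scale_pt _ (flip l (_, _))) in h2 *.
set B' := u (scale_pt _ (flip l b)) in h2 *.
have -> : A - s * A' - (B - s * B') = (A - B) - s * (A' - B') by ring.
apply: le_lt_trans (ler_normB _ _) _; rewrite (splitr e) normrM (gtr0_norm s0).
apply: ltrD => //; apply: le_lt_trans h2; rewrite ler_piMl //; exact: ltW.
Qed.

Lemma flip_diff_line u (rho s l : R) b d (t : R) :
  flip_diff u rho s l (line b d t) =
  u (line (scale_pt rho b) (scale_pt rho d) t) -
  s * u (line (scale_pt (rho / s) (flip l b)) (scale_pt (rho / s) (d.1, - d.2)) t).
Proof.
rewrite /flip_diff /line /scale_pt /flip /=; congr (u _ - s * u _); congr (_, _);
by ring.
Qed.

Lemma is_derive_flip_diff D u ux uy (rho s l : R) b d (t : R) :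
  open D -> C1_partials D u ux uy ->
  let P := line (scale_pt rho b) (scale_pt rho d) t in
  let Q := line (scale_pt (rho / s) (flip l b)) (scale_pt (rho / s) (d.1, - d.2)) t in
  D P -> D Q ->
  is_derive t 1 (fun t => flip_diff u rho s l (line b d t))
   ((rho * d.1 * ux P + rho * d.2 * uy P) -
     s * (rho / s * d.1 * ux Q + rho / s * - d.2 * uy Q)).
Proof.
move=> oD Cu P Q DP DQ.
have H1 := is_derive_line oD Cu DP; have H2 := is_derive_line oD Cu DQ.
have -> : (fun t => flip_diff u rho s l (line b d t)) =
  (fun t => u (line (scale_pt rho b) (scale_pt rho d) t)) -
  s *: (fun t => u (line (scale_pt (rho / s) (flip l b)) (scale_pt (rho / s) (d.1, - d.2)) t)).
  by apply/funext => x; rewrite flip_diff_line.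
exact: is_deriveB (is_deriveZ _ _).
Qed.

(* Shrinking [u] multiplies its Hessian determinant by [s ^- 2] without changing
   its gradient, so the two graphs cannot touch from one side at an interior
   point. *)
Lemma flip_diff_no_interior_min D u ux uy uxx uxy uyx uyy (G : R -> R)
    (rho s l : R) b :
  open D -> C1_partials D u ux uy -> C1_partials D ux uxx uxy ->
  C1_partials D uy uyx uyy -> convex_fun_on D u ->
  (forall p, D p -> uxx p * uyy p - uxy p * uyx p = G (ux p ^+ 2 + uy p ^+ 2)) ->
  (forall r, 0 < G r) -> 0 < rho -> 0 < s < 1 ->
  D (scale_pt rho b) -> D (scale_pt (rho / s) (flip l b)) ->
  ~ \forall q \near b, flip_diff u rho s l b <= flip_diff u rho s l q.
Proof.
move=> oD Cu Cx Cy cu pde G0 rho0 /andP[s0 s1] DP DQ minb.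
set P := scale_pt rho b in DP; set Q := scale_pt (rho / s) (flip l b) in DQ.
have sn : s != 0 by rewrite gt_eqF.
(* First and second order conditions at the minimum along each direction [d], the second divided by
   [rho ^+ 2]. The reflection changes the sign of the vertical slope and of the mixed derivative at
   [Q]. *)
have test d : rho * (d.1 * (ux P - ux Q) + d.2 * (uy P + uy Q)) = 0 /\
   0 <= (uxx P * d.1 ^+ 2 + 2 * uxy P * (d.1 * d.2) + uyy P * d.2 ^+ 2) -
     s^-1 * (uxx Q * d.1 ^+ 2 + 2 * (- uxy Q) * (d.1 * d.2) + uyy Q * d.2 ^+ 2).
  pose F t := flip_diff u rho s l (line b d t).
  pose Pt := line P (scale_pt rho d).
  pose Qt := line Q (scale_pt (rho / s) (d.1, - d.2)).
  pose dF t := (rho * d.1 * ux (Pt t) + rho * d.2 * uy (Pt t)) -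
     s * (rho / s * d.1 * ux (Qt t) + rho / s * - d.2 * uy (Qt t)).
  have n1 : \forall t \near (0 : R), is_derive (t : R) 1 F (dF t).
    have h1 := near_line (scale_pt rho d) (open_nbhs_nbhs (conj oD DP)).
    have h2 := near_line (scale_pt (rho / s) (d.1, - d.2)) (open_nbhs_nbhs (conj oD DQ)).
    by apply: filterS2 h1 h2 => t; exact: is_derive_flip_diff.
  have n2 : \forall t \near (0 : R), F 0 <= F t.
    by rewrite /F line0; exact: (near_line d minb).
  have DP0 : D (Pt 0) by rewrite /Pt line0.
  have DQ0 : D (Qt 0) by rewrite /Qt line0.
  have H1 := is_derive_line2 oD Cu Cx Cy DP0.
  have H2 := is_derive_line2 oD Cu Cx Cy DQ0.
  have n3 := is_deriveB H1 (is_deriveZ s H2).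
  have [] := second_derivative_test n1 n3 n2.
  rewrite /dF /Pt /Qt !line0 /= => e1 e2; split.
    by rewrite -e1; field.
  have r2 : 0 < rho ^+ 2 by rewrite exprn_gt0.
  rewrite -(pmulr_rge0 _ r2); move: e2; congr (0 <= _).
  by rewrite /GRing.scale /=; field.
have eqx : ux P = ux Q.
  have [/eqP + _] := test (1, 0); rewrite mulf_eq0 gt_eqF //= => /eqP; lra.
have eqy : uy P = - uy Q.
  have [/eqP + _] := test (0, 1); rewrite mulf_eq0 gt_eqF //= => /eqP; lra.
have comm := second_partials_comm oD Cu Cx Cy.
have eP := pde _ DP; have eQ := pde _ DQ.
rewrite -comm // -expr2 in eP; rewrite -comm // -expr2 in eQ.
have detQ : 0 < uxx Q * uyy Q - (- uxy Q) ^+ 2 by rewrite sqrrN eQ.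
have k1 : 1 < s^-1 by rewrite invf_gt1.
have := hessian_comparison k1 (convex_uxx_ge0 oD Cu Cx cu DQ) detQ.
move=> /(_ (uxx P) (uxy P) (uyy P)).
have H x y : s^-1 * (uxx Q * x ^+ 2 + 2 * - uxy Q * (x * y) + uyy Q * y ^+ 2) <=
    uxx P * x ^+ 2 + 2 * uxy P * (x * y) + uyy P * y ^+ 2.
  by have [_] := test (x, y); rewrite /= subr_ge0.
(* Both determinants are the same value of [G], since the gradients agree up to the sign of the
   vertical slope, while the comparison makes one strictly smaller. *)
by move=> /(_ H); rewrite sqrrN eP eQ eqx eqy sqrrN ltxx.
Qed.

End Reflection.

(** * Comparison of [u] with its reflection on a cap *)

Section ReflectionPrinciple.
Variable R : realType.
Implicit Types (p q b d : R * R) (D : set (R * R)) (u ux uy : R * R -> R).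

Lemma flip_scale (rho l : R) b : 
  flip (rho * l) (scale_pt rho b) = scale_pt rho (flip l b).
Proof. by rewrite /flip /scale_pt /=; congr (_, _); ring. Qed.

Lemma scale_ptA (s t : R) b : scale_pt s (scale_pt t b) = scale_pt (s * t) b.
Proof. by rewrite /scale_pt /= !mulrA. Qed.

Lemma scale_pt1 b : scale_pt 1 b = b.
Proof. by rewrite /scale_pt !mul1r; case: b. Qed.

(** The sum is the vertical derivative of [u] minus its reflection, taken slightly inside the curved
    boundary. Compactness of the lower boundary makes the local estimate uniform in [b]. *)
Lemma boundary_sum_lt0 D u ux uy (l : R) : open D -> strictly_convex_set D ->
  axially_symmetric D -> D (0, 0) -> D `<=` square (4 / 3) ->
  C1_partials D u ux uy -> convex_fun_on D u ->
  gradient_blowup D ux uy -> (forall p, D p -> {for p, continuous uy}) -> l < 0 ->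
  exists2 e : R, 0 < e & forall rho : R, 0 < rho < 1 -> `|rho - 1| < e ->
    forall b, boundary D b -> rho * b.2 <= l ->
    uy (scale_pt rho b) + uy (flip l (scale_pt rho b)) < 0.
Proof.
move=> oD scD aD D0 Dbd Cu cu bu cuy l0.
have [|e e0 He] := @compact_uniform R _ (fun rho b => 0 < rho < 1 ->
   rho * b.2 <= l -> uy (scale_pt rho b) + uy (flip l (scale_pt rho b)) < 0) 1
   (@boundary_below_compact R D oD Dbd l).
  move=> b [bb bl].
  have [e e0 He] := reflected_sum_lt0 oD scD aD Cu cu bu cuy l0 bb bl.
  have [e1 e10 H1] := scale_near b.1 e0; have [e2 e20 H2] := scale_near b.2 e0.
  exists (Num.min e1 e2); first by rewrite lt_min e10.
  move=> b' s [[cb' _] _]; rewrite !lt_min.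
  move=> /andP[x1 _] /andP[_ y2] /andP[s1 s2] s01 sl.
  have Ds : D (scale_pt s b').
    by apply: scale_closure => //; case/andP: s01 => s0 ->; rewrite ltW.
  have h1 := H1 _ _ s01 x1 s1; have h2 := H2 _ _ s01 y2 s2.
  apply: He => //; first exact: flip_in.
  have -> : (flip l (scale_pt s b')).2 - (2 * l - b.2) = - (s * b'.2 - b.2).
    by rewrite /flip /scale_pt /=; ring.
  by rewrite normrN.
exists e => // rho r01 re b bb bl; apply: (He rho re b _ r01 bl); split => //=.
move: bl; case/andP: r01 => r0 r1.
(* The covering was made for [b.2 <= l]; as [l < 0] and [rho < 1], this follows from
   [rho * b.2 <= l]. *)
have [b0|b0] := leP 0 b.2; first by have := mulr_ge0 (ltW r0) b0; lra.
by apply: le_trans; rewrite ler_nMl // ltW.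
Qed.

(** A violation forces a negative minimum of [flip_diff] on the closed cap. On the reflection line
    the function is too close to zero, in the interior the determinants clash, and on the curved
    boundary it decreases upwards. *)
Lemma reflection_le D u ux uy uxx uxy uyx uyy (G : R -> R) (l : R) p :
  open D -> strictly_convex_set D -> axially_symmetric D -> D (0, 0) ->
  D `<=` square (4 / 3) ->
  (forall p, D p -> {for p, continuous u}) ->
  C1_partials D u ux uy -> C1_partials D ux uxx uxy ->
  C1_partials D uy uyx uyy -> convex_fun_on D u -> gradient_blowup D ux uy ->
  (forall p, D p -> uxx p * uyy p - uxy p * uyx p = G (ux p ^+ 2 + uy p ^+ 2)) ->
  (forall r, 0 < G r) -> l < 0 -> D p -> p.2 <= l -> u (flip l p) <= u p.
Proof.
move=> oD scD aD D0 Dbd cont_u Cu Cx Cy cu bu pde G0 l0 Dp pl.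
rewrite leNgt; apply/negP => lt.
have cont_uy q : D q -> {for q, continuous uy}.
  by case: q => x y Dq; have [] := Cu _ _ Dq.
(* Shrinking the domain by [rho] makes the infimum attained; shrinking [u] by [s]
   makes the comparison strict. *)
pose k := (u (flip l p) - u p) / 2.
have k0 : 0 < k by rewrite divr_gt0 // subr_gt0.
have [e1 e10 H1] := boundary_sum_lt0 oD scD aD D0 Dbd Cu cu bu cont_uy l0.
(* [rho] is so close to 1 that [scale_pt rho^-1 p] is still in [D]; this point carries the violation
   in the dilated picture. *)
have [rho [r0 r1 re Dpr]] : exists rho : R, [/\ 0 < rho, rho < 1, `|rho - 1| < e1
    & D (scale_pt rho^-1 p)].
  have [r rp Hr] := open_planeP oD Dp.
  pose M : R := 1 + `|p.1| + `|p.2|.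
  have M0 : 0 < M by rewrite /M -addrA ltr_pwDl // addr_ge0.
  pose h := Num.min e1 (r / M) / 2.
  have m0 : 0 < Num.min e1 (r / M) by rewrite lt_min e10 divr_gt0.
  have h0 : 0 < h by rewrite divr_gt0.
  have [he hr] : h < e1 /\ h < r / M.
    by apply/andP; rewrite -lt_min /h ltr_pdivrMr // mulr_natr mulr2n ltrDl.
  have h1 : 0 < 1 + h by lra.
  exists (1 + h)^-1; split; first by rewrite invr_gt0.
  - by rewrite invf_lt1 //; lra.
  - have -> : (1 + h)^-1 - 1 = - (h / (1 + h)) by field; rewrite gt_eqF.
    rewrite normrN gtr0_norm ?divr_gt0 //; apply: le_lt_trans he.
    by rewrite ler_pdivrMr // ler_peMr // ?ltW //; lra.
  rewrite invrK; have -> : scale_pt (1 + h) p = (p.1 + h * p.1, p.2 + h * p.2).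
    by rewrite /scale_pt; congr (_, _); ring.
  have hM : h * M < r by rewrite -ltr_pdivlMr.
  by apply: Hr; apply: le_lt_trans hM; rewrite normrM (gtr0_norm h0) ler_wpM2l ?ltW //;
    rewrite /M; have := normr_ge0 p.1; have := normr_ge0 p.2; lra.
pose l1 := l / rho.
have ll : rho * l1 = l by rewrite /l1 mulrC divfK // gt_eqF.
have l10 : l1 < 0 by rewrite pmulr_llt0 ?invr_gt0.
have ble b : (b.2 <= l1) = (rho * b.2 <= l) by rewrite -ll ler_pM2l.
have closed_scale t b : 0 < t < 1 -> closure D b -> D (scale_pt t b).
  by move=> /andP[t0 t1] cb; apply: scale_closure => //; rewrite ltW.
have r01 : 0 < rho < 1 by rewrite r0.
(* At [s = 1] this is the strict inequality of [boundary_sum_lt0]; half of its margin goes to each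
   of the two terms when [s] and [b] vary. *)
have [|e2 e20 H2] := @compact_uniform R _ (fun s b =>
    uy (scale_pt rho b) + uy (scale_pt (rho / s) (flip l1 b)) < 0) 1
   (@boundary_below_compact R D oD Dbd l1).
  move=> b [bb /= bl]; have [cb _] := bb.
  have DP : D (scale_pt rho b) by exact: closed_scale.
  have DQ : D (scale_pt rho (flip l1 b)).
    by apply: closed_scale => //; exact: flip_closure.
  have := H1 rho r01 re b bb; rewrite -ble -ll flip_scale => /(_ bl) neg.
  have eps0 : 0 < - (uy (scale_pt rho b) + uy (scale_pt rho (flip l1 b))) / 2.
    by rewrite divr_gt0 // oppr_gt0.
  have [ea ea0 Ha] := continuous_scale r0 (cont_uy _ DP) eps0.
  have [eb eb0 Hb] := continuous_scale r0 (cont_uy _ DQ) eps0.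
  exists (Num.min ea eb); first by rewrite lt_min ea0.
  move=> b' s _; rewrite !lt_min => /andP[x1 x2] /andP[y1 y2] /andP[_ s2].
  have := Ha b' 1 x1 y1; rewrite subrr normr0 divr1 => /(_ ea0)/ltr_normlP[_ h1].
  have := Hb (flip l1 b') s x2; rewrite /=.
  have -> : 2 * l1 - b'.2 - (2 * l1 - b.2) = - (b'.2 - b.2) by ring.
  rewrite normrN => /(_ y2 s2)/ltr_normlP[_ h2].
  by move: h1 h2; clear; lra.
have [|e3 e30 H3] := @compact_uniform R _ (fun s b =>
    `|s * u (scale_pt (rho / s) (flip l1 b)) - u (scale_pt rho (flip l1 b))| < k) 1
   (@below_compact R D Dbd l1).
  move=> b [cb /= bl].
  have DQ : D (scale_pt rho (flip l1 b)).
    by apply: closed_scale => //; exact: flip_closure.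
  set q := flip l1 b in DQ *; set v := u (scale_pt rho q).
  have k4 : 0 < k / 4 by rewrite divr_gt0.
  have [ea ea0 Ha] := continuous_scale r0 (cont_u _ DQ) k4.
  have v0 : 0 < `|v| + k / 4 by rewrite ltr_wpDl.
  (* This range of [s] keeps [(s - 1) * A] within [k / 4], as [|A| <= |v| + k / 4]; three such
     errors stay below [k]. *)
  exists (Num.min ea (k / 4 / (`|v| + k / 4))); first by rewrite lt_min ea0 divr_gt0.
  move=> b' s _; rewrite !lt_min => /andP[x1 _] /andP[y1 _] /andP[s1 s2].
  have hy : `|(flip l1 b').2 - q.2| < ea.
    have -> : (flip l1 b').2 - q.2 = - (b'.2 - b.2) by rewrite /q /flip /=; ring.
    by rewrite normrN.
  have h1 := Ha (flip l1 b') 1 x1 hy; rewrite subrr normr0 divr1 in h1.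
  have {h1} := h1 ea0; have := Ha (flip l1 b') s x1 hy s1.
  rewrite -/v; set A := u _; set B := u _ => h2 h1.
  have -> : s * A - B = (s - 1) * A + (A - v) - (B - v) by ring.
  have hA : `|A| <= `|v| + k / 4.
    have -> : A = v + (A - v) by ring.
    by apply: le_trans (ler_normD _ _) _; rewrite lerD2l ltW.
  have h3 : `|(s - 1) * A| <= k / 4.
    rewrite normrM; apply: (@le_trans _ _ (`|s - 1| * (`|v| + k / 4))).
      by rewrite ler_wpM2l.
    by rewrite -ler_pdivlMr // ltW.
  apply: le_lt_trans (ler_normB _ _) _.
  apply: (@le_lt_trans _ _ (`|(s - 1) * A| + `|A - v| + `|B - v|)).
    by rewrite lerD2r ler_normD.
  by move: h1 h2 h3 k0; clear; lra.
have [s [s0 s1 rs se2 se3]] : exists s : R,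
    [/\ 0 < s, s < 1, rho < s, `|s - 1| < e2 & `|s - 1| < e3].
  pose m := Num.min e2 (Num.min e3 (1 - rho)).
  have m0 : 0 < m by rewrite !lt_min e20 e30 subr_gt0.
  have [m2 [m3 mr]] : m <= e2 /\ m <= e3 /\ m <= 1 - rho.
    by rewrite /m !ge_min !lexx ?orbT.
  exists (1 - m / 2).
  have -> : 1 - m / 2 - 1 = - (m / 2) by ring.
  rewrite normrN gtr0_norm ?divr_gt0 //.
  by move: m0 m2 m3 mr r0; clear; split; lra.
have s01 : 0 < s < 1 by rewrite s0.
have rs1 : 0 < rho / s < 1 by rewrite divr_gt0 //= ltr_pdivrMr // mul1r.
pose K := closure D `&` [set b | b.2 <= l1].
pose w := flip_diff u rho s l1.
have KP b : K b -> D (scale_pt rho b) by move=> [cb _]; exact: closed_scale.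
have KQ b : K b -> D (scale_pt (rho / s) (flip l1 b)).
  by move=> [cb bl]; apply: closed_scale => //; exact: flip_closure.
pose b1 := scale_pt rho^-1 p.
have rb1 : scale_pt rho b1 = p by rewrite /b1 scale_ptA divff ?gt_eqF // scale_pt1.
have Kb1 : K b1.
  split; first exact: subset_closure.
  have := ble b1; rewrite -[rho * b1.2]/(scale_pt rho b1).2 rb1 => E.
  by rewrite /mkset E.
have [||b0 /set_mem Kb0 minb] := @compact_EVT_min _ R w K _ (@below_compact R D Dbd l1).
- by exists b1.
- apply: continuous_in_subspaceT => b /set_mem Kb.
  exact: (continuous_flip_diff cont_u r0 s01 (KP _ Kb) (KQ _ Kb)).
have wlt : w b0 < - k.
  apply: (@le_lt_trans _ _ (w b1)); first by apply: minb; rewrite inE.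
  have := H3 s se3 b1 Kb1; rewrite -(flip_scale rho) ll rb1 => /ltr_normlP[h _].
  rewrite /w /flip_diff rb1.
  have e : u (flip l p) - u p = k + k by rewrite /k -splitr.
  by move: h e; clear; lra.
have [cb0 bl0] := Kb0; rewrite /= in bl0.
(* On the line the reflection fixes [b0], so [flip_diff] differs from zero by less than [k], against
   [wlt]. *)
have {bl0} bl0 : b0.2 < l1.
  rewrite lt_neqAle bl0 andbT; apply/eqP => be.
  have fb : flip l1 b0 = b0.
    by case: (b0) be => x y /= ->; rewrite /flip /=; congr (_, _); ring.
  have := H3 s se3 b0 Kb0; rewrite fb => /ltr_normlP[_ h].
  by move: wlt h; rewrite /w /flip_diff fb; clear; lra.
have [Db0|nDb0] := pselect (D b0).
  apply: (flip_diff_no_interior_min oD Cu Cx Cy cu pde G0 r0 s01 (KP _ Kb0) (KQ _ Kb0)).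
  have oK : open (D `&` [set q | q.2 < l1]).
    apply: openI => //.
    rewrite -[X in open X]/(snd @^-1` [set x : R | x < l1]).
    by apply: open_comp => [x _|]; [exact: cvg_snd|exact: open_lt].
  have : \forall q \near b0, (D `&` [set q | q.2 < l1]) q.
    by apply: open_nbhs_nbhs; split.
  apply: filterS => q [Dq ql]; apply: minb; rewrite inE; split.
    exact: subset_closure.
  exact: ltW.
(* On the curved boundary the upward derivative of [flip_diff] is [rho] times the negative sum from
   [H2], so a short step up inside the cap goes below the minimum. *)
have bb0 : boundary D b0 by [].
have neg := H2 s se2 b0 (conj bb0 (ltW bl0)).
have dw := @is_derive_flip_diff R D u ux uy rho s l1 b0 (0, 1) 0 oD Cu.
rewrite /= !line0 in dw; have {}dw := dw (KP _ Kb0) (KQ _ Kb0).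
move: dw; set L := (X in is_derive _ _ _ X) => dw.
have L0 : L < 0.
  have -> : L = rho * (uy (scale_pt rho b0) + uy (scale_pt (rho / s) (flip l1 b0))).
    by rewrite /L; field; rewrite gt_eqF.
  by rewrite pmulr_rlt0.
(* The two bounds on the step keep the new point below the line and below the mirror image of [b0],
   hence in the cap. *)
have m0 : 0 < Num.min (l1 - b0.2) (- 2 * b0.2).
  by rewrite !lt_min subr_gt0 bl0 /=; move: bl0 l10; clear; lra.
have [h /andP[h0 hm] [+ _]] := derive_lt0_step dw L0 m0.
move: hm; rewrite lt_min add0r line0 => /andP[hl hb]; rewrite ltNge => /negP; apply.
apply: minb; rewrite inE /line /= mulr0 addr0 mulr1.
split; last by rewrite /=; move: hl; clear; lra.
apply/subset_closure/(vertical_segment scD aD (y := b0.2)).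
  by rewrite -surjective_pairing.
by move: h0 hb; clear; lra.
Qed.

End ReflectionPrinciple.

(** * Sign of the vertical slope, and derivatives of inverse powers *)

Section Barrier.
Variable R : realType.
Implicit Types (p q b d : R * R) (D : set (R * R)) (u ux uy : R * R -> R).

(** Reflection in the horizontal line through [p] gives [u (x, y + h) <= u (x, y - h)]; a positive
    slope at [p] would reverse this for small [h]. *)
Lemma uy_le0 D u ux uy uxx uxy uyx uyy (G : R -> R) p :
  open D -> strictly_convex_set D -> axially_symmetric D -> D (0, 0) ->
  D `<=` square (4 / 3) ->
  (forall p, D p -> {for p, continuous u}) ->
  C1_partials D u ux uy -> C1_partials D ux uxx uxy ->
  C1_partials D uy uyx uyy -> convex_fun_on D u -> gradient_blowup D ux uy ->
  (forall p, D p -> uxx p * uyy p - uxy p * uyx p = G (ux p ^+ 2 + uy p ^+ 2)) ->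
  (forall r, 0 < G r) -> D p -> p.2 < 0 -> uy p <= 0.
Proof.
case: p => x y oD scD aD D0 Dbd cont_u Cu Cx Cy cu bu pde G0 Dp /= y0.
rewrite leNgt; apply/negP => pos.
have [r r0 Hr] := open_planeP oD Dp.
have [_ dy _ _] := Cu _ _ Dp.
have dF : is_derive (0 : R) 1 (fun h => u (x, y - h) - u (x, y + h)) (- (uy (x, y) + uy (x, y))).
  have e1 : u (x, y) = u (line (x, y) (0, 1) 0) by rewrite line0.
  have H1 := @is_derive_line R D u ux uy (x, y) (0, 1) 0 oD Cu.
  have H2 := @is_derive_line R D u ux uy (x, y) (0, -1) 0 oD Cu.
  rewrite !line0 /= in H1 H2.
  have := is_deriveB (H2 Dp) (H1 Dp).
  have -> : (fun s => u (line (x, y) (0, -1) s)) - (fun s => u (line (x, y) (0, 1) s)) =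
    (fun h => u (x, y - h) - u (x, y + h)).
    by apply/funext => h; rewrite !fctE /line /= !mulr0 !addr0 mulr1 mulrN1.
  by move/is_derive_eq; apply; ring.
have [|h /andP[h0 hr] [+ _]] := derive_lt0_step dF _ r0; first by lra.
rewrite !add0r subr0 addr0 subrr subr_lt0 ltNge => /negP; apply.
have Dh : D (x, y - h).
  by have := Hr 0 (- h); rewrite /= addr0 normr0 normrN gtr0_norm //; apply.
have := reflection_le oD scD aD D0 Dbd cont_u Cu Cx Cy cu bu pde G0 y0 Dh.
rewrite /flip /=; have -> : 2 * y - (y - h) = y + h by ring.
by apply; rewrite gerBl ltW.
Qed.

Lemma is_derive_inv_sq (S : R -> R) (c x S1 : R) : is_derive x 1 S S1 -> S x != 0 ->
  is_derive x 1 (fun t => c * (S t ^+ 2)^-1) (- 2 * c * S1 * (S x ^+ 3)^-1).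
Proof.
move=> dS Sx.
have S2 : S x ^+ 2 != 0 by rewrite expf_neq0.
have dX : is_derive x 1 (fun t => S t ^+ 2) (S x *+ 2 *: S1).
  have -> : (fun t => S t ^+ 2) = S * S by apply/funext => t; rewrite fctE expr2.
  by have := is_deriveM dS dS; move/is_derive_eq; apply; rewrite /GRing.scale /=; ring.
have dV := @is_deriveV R (fun t => S t ^+ 2) _ _ _ S2 dX.
have := is_deriveZ c dV; move/is_derive_eq; apply.
by rewrite /GRing.scale /=; field.
Qed.

Lemma is_derive_inv_cube (S S1 : R -> R) (c x S2 : R) : is_derive x 1 S (S1 x) ->
  is_derive x 1 S1 S2 -> S x != 0 ->
  is_derive x 1 (fun t => - 2 * c * S1 t * (S t ^+ 3)^-1)
    (c * (6 * S1 x ^+ 2 * (S x ^+ 4)^-1 - 2 * S2 * (S x ^+ 3)^-1)).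
Proof.
move=> dS dS1 Sx.
have S3 : S x ^+ 3 != 0 by rewrite expf_neq0.
have dX : is_derive x 1 (fun t => S t ^+ 3) (S x ^+ 2 *+ 3 *: S1 x).
  have -> : (fun t => S t ^+ 3) = S * (S * S).
    by apply/funext => t; rewrite !fctE; ring.
  have := is_deriveM dS (is_deriveM dS dS); move/is_derive_eq; apply.
  by rewrite /GRing.scale /= fctE; ring.
have dV := @is_deriveV R (fun t => S t ^+ 3) _ _ _ S3 dX.
have dZ : is_derive x 1 (fun t => - 2 * c * S1 t) (- 2 * c * S2) := is_deriveZ _ dS1.
have dM := is_deriveM dZ dV.
move/is_derive_eq: dM; apply.
by rewrite /GRing.scale /=; field.
Qed.

Lemma is_derive_sqrt_comp (q : R -> R) (x q1 : R) : 0 < q x -> is_derive x 1 q q1 ->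
  is_derive x 1 (fun t => Num.sqrt (q t)) (q1 / (2 * Num.sqrt (q x))).
Proof.
move=> qx dq; have ds := @is_derive1_sqrt _ _ qx.
have := is_derive1_comp ds dq; move/is_derive_eq; apply.
by rewrite mulrC.
Qed.

Lemma is_derive_div_sqrt (q q1 : R -> R) (c x q2 : R) : 0 < q x ->
  is_derive x 1 q (q1 x) -> is_derive x 1 q1 q2 ->
  is_derive x 1 (fun t => c * (q1 t / (2 * Num.sqrt (q t))))
    (c * (2 * q2 * q x - q1 x ^+ 2) / (4 * Num.sqrt (q x) ^+ 3)).
Proof.
move=> qx dq dq1.
have s0 : 0 < Num.sqrt (q x) by rewrite sqrtr_gt0.
have sn : 2 * Num.sqrt (q x) != 0 by rewrite gt_eqF // mulr_gt0.
have ds := is_derive_sqrt_comp qx dq.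
have dV := @is_deriveV R (fun t => 2 * Num.sqrt (q t)) _ _ _ sn (is_deriveZ 2 ds).
have dM : is_derive x 1 (fun t => q1 t / (2 * Num.sqrt (q t))) _ := is_deriveM dq1 dV.
have := is_deriveZ c dM; move/is_derive_eq; apply.
have e : q x = Num.sqrt (q x) ^+ 2 by rewrite sqr_sqrtr // ltW.
rewrite /GRing.scale /=; move: (Num.sqrt (q x)) s0 e => s s0 ->.
by field; rewrite gt_eqF.
Qed.

End Barrier.

(** * The pointwise inequality satisfied by the barrier *)

Section BarrierInequality.
Variable R : realType.

(** Here [a] and [b] stand for the two square roots in the barrier, [g] for [depth1] and [s] for
    [root_sum]. Squaring removes the exponent [3 / 2]. With [K * c = 9] both sides are compared
    through multiples of [(c ^+ 2 * W) ^+ 2], and the claim reduces to [625 / 1024 < 81 / 125]. *)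
Lemma barrier_ineq (K al a b g c s a1 a2 b1 b2 vx vy vxx vyy : R) :
  0 < K -> 0 < al -> 0 < a -> 0 < b ->
  a ^+ 2 <= 3 * al -> g ^+ 2 = 1 - b ^+ 2 / al ->
  c = 9 / K -> s = a + 2^-1 * b ->
  a1 = - 1 / (2 * a) -> a2 = - 1 / (4 * a ^+ 3) ->
  b1 = g / (4 * b) -> b2 = - 1 / (8 * b ^+ 3) ->
  vx = - 2 * c * a1 * (s ^+ 3)^-1 ->
  vy = - 2 * c * b1 * (s ^+ 3)^-1 ->
  vxx = c * (6 * a1 ^+ 2 * (s ^+ 4)^-1 - 2 * a2 * (s ^+ 3)^-1) ->
  vyy = c * (6 * b1 ^+ 2 * (s ^+ 4)^-1 - 2 * b2 * (s ^+ 3)^-1) ->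
  (vxx * vyy) ^+ 2 < K ^+ 2 * (1 + (vx ^+ 2 + vy ^+ 2)) ^+ 3.
Proof.
move=> K0 al0 a0 b0 aal g2 cE sE a1E a2E b1E b2E vxE vyE vxx' vyy'.
have c0 : 0 < c by rewrite cE divr_gt0.
have s0 : 0 < s by rewrite sE addr_gt0 // mulr_gt0.
have [an bn sn Kn aln] : [/\ a != 0, b != 0, s != 0, K != 0 & al != 0].
  by split; rewrite gt_eqF.
pose W := (a ^+ 3 * b ^+ 3 * s ^+ 6)^-1.
have W0 : 0 < W by rewrite invr_gt0 !mulr_gt0 // exprn_gt0.
have vxxE : vxx = c * (3 * a + s) / (2 * a ^+ 3 * s ^+ 4).
  by rewrite vxx' a1E a2E; field; rewrite an sn.
have vyyE : vyy = c * (3 * b * g ^+ 2 + 2 * s) / (8 * b ^+ 3 * s ^+ 4).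
  by rewrite vyy' b1E b2E; field; rewrite bn sn.
have g1 : g ^+ 2 <= 1 by rewrite g2 gerBl divr_ge0 ?sqr_ge0 // ltW.
have vxx0 : 0 <= vxx.
  by rewrite vxxE divr_ge0 // ?ltW // ?mulr_gt0 // ?exprn_gt0 // !(addr_gt0, mulr_gt0).
have vyy0 : 0 <= vyy.
  have n0 : 0 <= 3 * b * g ^+ 2.
    by apply: mulr_ge0; [rewrite ltW // mulr_gt0|exact: sqr_ge0].
  have n1 : 0 < 3 * b * g ^+ 2 + 2 * s by rewrite ltr_wpDl // mulr_gt0.
  by rewrite vyyE divr_ge0 // ltW // !mulr_gt0 // exprn_gt0.
(* The difference [25 / 2 * s ^+ 2 - (3 * a + s) * (3 * b + 2 * s)] is [9 / 2 * (a - b / 2) ^+ 2];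
   division by 16 gives [25 / 32]. *)
have prod : vxx * vyy <= c ^+ 2 * (25 / 32) * W.
  have -> : vxx * vyy =
      c ^+ 2 * ((3 * a + s) * (3 * b * g ^+ 2 + 2 * s) / (16 * s ^+ 2)) * W.
    by rewrite vxxE vyyE /W; field; rewrite an bn sn.
  rewrite ler_wpM2r ?(ltW W0) // ler_wpM2l ?sqr_ge0 // ler_pdivrMr; last first.
    by rewrite mulr_gt0 // exprn_gt0.
  apply: (@le_trans _ _ ((3 * a + s) * (3 * b + 2 * s))).
    apply: ler_wpM2l; first by rewrite ltW // addr_gt0 // mulr_gt0.
    by rewrite lerD2r ler_piMr // mulr_ge0 // ltW.
  have : 0 <= (a - 2^-1 * b) ^+ 2 by rewrite sqr_ge0.
  by rewrite sE; clear; lra.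
(* The bound [a ^+ 2 <= 3 * al], the width of the box, limits the loss from [g]; what remains is [(a
   + b / 2) ^+ 2 <= 5 / 4 * (a ^+ 2 + b ^+ 2)]. *)
have grad : c ^+ 2 / (5 * a ^+ 2 * b ^+ 2 * s ^+ 4) <= vx ^+ 2 + vy ^+ 2.
  have -> : vx ^+ 2 + vy ^+ 2 =
    c ^+ 2 / (5 * a ^+ 2 * b ^+ 2 * s ^+ 4) * (5 * (b ^+ 2 + a ^+ 2 * g ^+ 2 / 4) / s ^+ 2).
    by rewrite vxE vyE a1E b1E; field; rewrite an bn sn.
  rewrite ler_peMr //; first by rewrite divr_ge0 ?sqr_ge0 // ltW // !mulr_gt0 // exprn_gt0.
  rewrite ler_pdivlMr ?exprn_gt0 // mul1r.
  have h : a ^+ 2 * (b ^+ 2 / al) <= 3 * b ^+ 2.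
    have -> : 3 * b ^+ 2 = (3 * al) * (b ^+ 2 / al) by field.
    by rewrite ler_wpM2r // divr_ge0 ?sqr_ge0 // ltW.
  have h2 : 0 <= (a / 2 - b) ^+ 2 by rewrite sqr_ge0.
  have -> : a ^+ 2 * g ^+ 2 = a ^+ 2 - a ^+ 2 * (b ^+ 2 / al) by rewrite g2; ring.
  by rewrite sE; move: h h2; clear; lra.
apply: (@le_lt_trans _ _ ((c ^+ 2 * (25 / 32) * W) ^+ 2)).
  by rewrite ler_sqr // nnegrE ?mulr_ge0 // ?sqr_ge0 ?ltW.
have Z0 : 0 <= c ^+ 2 / (5 * a ^+ 2 * b ^+ 2 * s ^+ 4).
  by rewrite divr_ge0 ?sqr_ge0 // ltW // !mulr_gt0 // exprn_gt0.
apply: (@lt_trans _ _ (K ^+ 2 * (c ^+ 2 / (5 * a ^+ 2 * b ^+ 2 * s ^+ 4)) ^+ 3)).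
  have -> : K ^+ 2 * (c ^+ 2 / (5 * a ^+ 2 * b ^+ 2 * s ^+ 4)) ^+ 3 =
    (c ^+ 2 * W) ^+ 2 * (81 / 125).
    by rewrite /W cE; field; rewrite an bn sn Kn.
  have -> : (c ^+ 2 * (25 / 32) * W) ^+ 2 = (c ^+ 2 * W) ^+ 2 * (625 / 1024) by field.
  by rewrite ltr_pM2l ?exprn_gt0 // ?mulr_gt0 ?exprn_gt0 //; lra.
have ZV : c ^+ 2 / (5 * a ^+ 2 * b ^+ 2 * s ^+ 4) < 1 + (vx ^+ 2 + vy ^+ 2).
  by move: grad; clear; lra.
by rewrite ltr_pM2l ?exprn_gt0 // ltrXn2r // (le_trans Z0) // ltW.
Qed.

End BarrierInequality.

(** * The barrier *)

Section Box.
Variable R : realType.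
Implicit Types (p : R * R) (D : set (R * R)) (u ux uy : R * R -> R).

Section OneVariable.
Variables (q q1 : R -> R) (c k m x q2 : R).
Hypotheses (qx : 0 < q x) (dq : is_derive x 1 q (q1 x)) (dq1 : is_derive x 1 q1 q2).
Let S t := m * Num.sqrt (q t) + k.
Let S1 t := m * (q1 t / (2 * Num.sqrt (q t))).
Hypothesis Sx : S x != 0.

Let dS : is_derive x 1 S (S1 x).
Proof.
have := is_deriveD (is_deriveZ m (is_derive_sqrt_comp qx dq)) (is_derive_cst k x 1).
by move/is_derive_eq; apply; rewrite addr0.
Qed.

(** One formula serves both variables: [m = 1] and [q t = 1 - t] in [x], [m = 1 / 2] and [q = depth]
    in [y], with the other root in [k]. *)
Lemma is_derive_inv_sq_sqrt :
  is_derive x 1 (fun t => c * ((m * Num.sqrt (q t) + k) ^+ 2)^-1)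
    (- 2 * c * (m * (q1 x / (2 * Num.sqrt (q x)))) *
      ((m * Num.sqrt (q x) + k) ^+ 3)^-1).
Proof. exact: (is_derive_inv_sq c dS Sx). Qed.

Lemma is_derive2_inv_sq_sqrt :
  is_derive x 1 (fun t => - 2 * c * (m * (q1 t / (2 * Num.sqrt (q t)))) *
      ((m * Num.sqrt (q t) + k) ^+ 3)^-1)
    (c * (6 * (m * (q1 x / (2 * Num.sqrt (q x)))) ^+ 2 *
             ((m * Num.sqrt (q x) + k) ^+ 4)^-1 -
          2 * (m * (2 * q2 * q x - q1 x ^+ 2) / (4 * Num.sqrt (q x) ^+ 3)) *
             ((m * Num.sqrt (q x) + k) ^+ 3)^-1)).
Proof.
exact: (is_derive_inv_cube c dS (is_derive_div_sqrt m qx dq dq1) Sx).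
Qed.

End OneVariable.

Variables (c al ys : R).

(* In the quadrant [X, Y > 0] a multiple of [(sqrt X + sqrt Y / 2) ^- 2] satisfies
   [v_xx v_yy <= K |Dv|^3] and has infinite slope on both sides.  Replacing [Y] by
   the arc [depth] makes the barrier symmetric about [y = ys + 2 * al], so that it
   increases in [y] beyond that line. *)
Definition depth (y : R) : R := (y - ys) - (y - ys) ^+ 2 / (4 * al).
Definition depth1 (y : R) : R := 1 - (y - ys) / (2 * al).
Definition root_sum p : R := Num.sqrt (1 - p.1) + 2^-1 * Num.sqrt (depth p.2).
Definition barrier p : R := c * (root_sum p ^+ 2)^-1.
Definition barrier_x p : R :=
  - 2 * c * (- 1 / (2 * Num.sqrt (1 - p.1))) * (root_sum p ^+ 3)^-1.
Definition barrier_y p : R :=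
  - 2 * c * (depth1 p.2 / (4 * Num.sqrt (depth p.2))) * (root_sum p ^+ 3)^-1.
Definition barrier_xx p : R :=
  c * (6 * (- 1 / (2 * Num.sqrt (1 - p.1))) ^+ 2 * (root_sum p ^+ 4)^-1 -
       2 * (- 1 / (4 * Num.sqrt (1 - p.1) ^+ 3)) * (root_sum p ^+ 3)^-1).
Definition barrier_yy p : R :=
  c * (6 * (depth1 p.2 / (4 * Num.sqrt (depth p.2))) ^+ 2 * (root_sum p ^+ 4)^-1 -
       2 * (- 1 / (8 * Num.sqrt (depth p.2) ^+ 3)) * (root_sum p ^+ 3)^-1).

Hypothesis al0 : 0 < al.

(** This identity explains the choice of the arc: it gives the second derivative of the square root
    of [depth] a constant numerator, as for a plain square root, and it is the relation on [g] in
    [barrier_ineq]. *)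
Lemma depth1_sq y : depth1 y ^+ 2 = 1 - depth y / al.
Proof. by rewrite /depth1 /depth; field; rewrite gt_eqF. Qed.

Lemma root_sum_gt0 (x y : R) : x < 1 -> 0 < depth y -> 0 < root_sum (x, y).
Proof.
by move=> x1 dy; rewrite addr_gt0 ?mulr_gt0 // sqrtr_gt0 // subr_gt0.
Qed.

Lemma is_derive_depth (y : R) : is_derive y 1 depth (depth1 y).
Proof.
have d1 : is_derive y 1 (fun t : R => t - ys) 1.
  by have := is_deriveB (is_derive_id y 1) (is_derive_cst ys y 1);
    move/is_derive_eq; apply; rewrite subr0.
have := is_deriveB d1 (is_deriveZ ((4 * al)^-1) (is_deriveM d1 d1)).
have -> : (fun t : R => t - ys) - (4 * al)^-1 *: ((fun t : R => t - ys) * (fun t : R => t - ys)) = depth.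
  apply/funext => t; rewrite /depth -[LHS]/((t - ys) - (4 * al)^-1 * ((t - ys) * (t - ys))).
  by rewrite mulrC expr2.
move/is_derive_eq; apply; rewrite /depth1 /GRing.scale /=.
by field; rewrite gt_eqF.
Qed.

Lemma is_derive_depth1 (y : R) : is_derive y 1 depth1 (- (2 * al)^-1).
Proof.
have d1 : is_derive y 1 (fun t : R => t - ys) 1.
  by have := is_deriveB (is_derive_id y 1) (is_derive_cst ys y 1);
    move/is_derive_eq; apply; rewrite subr0.
have := is_deriveB (is_derive_cst (1 : R) y 1) (is_deriveZ ((2 * al)^-1) d1).
have -> : cst (1 : R) - (2 * al)^-1 *: (fun t : R => t - ys) = depth1.
  apply/funext => t; rewrite /depth1 -[LHS]/(1 - (2 * al)^-1 * (t - ys)).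
  by rewrite mulrC.
by move/is_derive_eq; apply; rewrite /GRing.scale /= mulr1 sub0r.
Qed.

Lemma is_derive_1B (x : R) : is_derive x 1 (fun t : R => 1 - t) (- 1).
Proof.
have := is_deriveB (is_derive_cst (1 : R) x 1) (is_derive_id x 1).
by move/is_derive_eq; apply; rewrite sub0r.
Qed.

Section Point.
Variables (x y : R).
Hypotheses (x1 : x < 1) (dy : 0 < depth y).

Let Sn : root_sum (x, y) != 0.
Proof. by rewrite gt_eqF // root_sum_gt0. Qed.

Lemma barrier_dx : is_derive x 1 (fun t => barrier (t, y)) (barrier_x (x, y)).
Proof.
have q0 : 0 < 1 - x by rewrite subr_gt0.
have := @is_derive_inv_sq_sqrt _ (fun=> - 1) c (2^-1 * Num.sqrt (depth y)) 1 x q0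
  (is_derive_1B x).
rewrite mul1r => /(_ Sn) H.
have -> : (fun t => barrier (t, y)) =
   (fun t => c * ((1 * Num.sqrt (1 - t) + 2^-1 * Num.sqrt (depth y)) ^+ 2)^-1).
  by apply/funext => t; rewrite mul1r.
by move: H => /is_derive_eq; apply; rewrite mul1r.
Qed.

Lemma barrier_dxx : is_derive x 1 (fun t => barrier_x (t, y)) (barrier_xx (x, y)).
Proof.
have q0 : 0 < 1 - x by rewrite subr_gt0.
have := @is_derive2_inv_sq_sqrt _ (fun=> - 1) c (2^-1 * Num.sqrt (depth y)) 1 x 0 q0
  (is_derive_1B x) (is_derive_cst (- 1 : R) x 1).
rewrite mul1r => /(_ Sn) H.
have -> : (fun t => barrier_x (t, y)) =
  (fun t => - 2 * c * (1 * (- 1 / (2 * Num.sqrt (1 - t)))) *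
      ((1 * Num.sqrt (1 - t) + 2^-1 * Num.sqrt (depth y)) ^+ 3)^-1).
  by apply/funext => t; rewrite !mul1r.
move: H => /is_derive_eq; apply.
have -> : 1 * (2 * 0 * (1 - x) - (-1) ^+ 2) = - 1 :> R by ring.
by rewrite !mul1r.
Qed.

Lemma barrier_dy : is_derive y 1 (fun t => barrier (x, t)) (barrier_y (x, y)).
Proof.
have := @is_derive_inv_sq_sqrt _ depth1 c (Num.sqrt (1 - x)) 2^-1 y dy
  (is_derive_depth y).
rewrite addrC => /(_ Sn) H.
have -> : (fun t => barrier (x, t)) =
   (fun t => c * ((2^-1 * Num.sqrt (depth t) + Num.sqrt (1 - x)) ^+ 2)^-1).
  by apply/funext => t; rewrite addrC.
move: H => /is_derive_eq; apply; rewrite /barrier_y /root_sum /=.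
by congr (_ * _ * _); field; rewrite gt_eqF // sqrtr_gt0.
Qed.

Lemma barrier_dyy : is_derive y 1 (fun t => barrier_y (x, t)) (barrier_yy (x, y)).
Proof.
have := @is_derive2_inv_sq_sqrt _ depth1 c (Num.sqrt (1 - x)) 2^-1 y _ dy
  (is_derive_depth y) (is_derive_depth1 y).
rewrite addrC => /(_ Sn) H.
have E t : depth1 t / (4 * Num.sqrt (depth t)) =
   2^-1 * (depth1 t / (2 * Num.sqrt (depth t))).
  by rewrite !invfM !mulrA; congr (_ * _); field.
have -> : (fun t => barrier_y (x, t)) =
  (fun t => - 2 * c * (2^-1 * (depth1 t / (2 * Num.sqrt (depth t)))) *
      ((2^-1 * Num.sqrt (depth t) + Num.sqrt (1 - x)) ^+ 3)^-1).
  by apply/funext => t; rewrite -E addrC.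
move: H => /is_derive_eq; apply; rewrite /barrier_yy /= -E /root_sum /=.
congr (_ * (_ - _ * _ * _)).
have b0 : 0 < Num.sqrt (depth y) by rewrite sqrtr_gt0.
rewrite depth1_sq.
field; rewrite gt_eqF // gt_eqF //.
Qed.

End Point.

Lemma barrier_continuous p : p.1 < 1 -> 0 < depth p.2 -> {for p, continuous barrier}.
Proof.
move=> p1 dp; have Sp := root_sum_gt0 p1 dp; rewrite -surjective_pairing in Sp.
have c1 : (fun p : R * R => 1 - p.1) @ p --> 1 - p.1.
  by apply: cvgB; [exact: cvg_cst|exact: cvg_fst].
have c2 : (fun p : R * R => depth p.2) @ p --> depth p.2.
  apply: (@continuous_comp _ _ _ snd depth); first exact: cvg_snd.
  exact: is_derive_continuous (is_derive_depth p.2).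
have c3 : root_sum @ p --> root_sum p.
  apply: cvgD; first exact: cvg_comp c1 (@sqrt_continuous _ _).
  by apply: cvgMr; exact: cvg_comp c2 (@sqrt_continuous _ _).
apply: cvgMr; apply: cvgV; first by rewrite expf_neq0 // gt_eqF.
by rewrite expr2; apply: cvgM.
Qed.

End Box.

(** * Comparison with the barrier on a box *)

Section BoxBound.
Variable R : realType.
Implicit Types (p : R * R) (D : set (R * R)) (u ux uy : R * R -> R).

(** By compactness of the square; [C] is the slope that the barrier has to exceed on the right and
    bottom sides. *)
Lemma gradient_bounded D ux uy : square 1 `<=` D ->
  (forall p, D p -> {for p, continuous ux}) ->
  (forall p, D p -> {for p, continuous uy}) ->
  exists2 C : R, 0 < C & forall p, square 1 p -> `|ux p| < C /\ `|uy p| < C.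
Proof.
move=> sD cx cy; pose f p : R := `|ux p| + `|uy p|.
have sE p : square 1 p <-> (`[-1, 1] `*` `[-1, 1] : set (R * R)) p.
  by rewrite /square /=; split=> -[]; rewrite /= !in_itv.
have [|||m _ Hm] := @compact_EVT_max _ R f (`[-1, 1] `*` `[-1, 1]).
- by exists (0, 0); split; rewrite /= in_itv /= lerN10 ler01.
- by apply: compact_setX; exact: segment_compact.
- apply: continuous_in_subspaceT => p /set_mem /sE/sD Dp.
  by apply: cvgD; apply: cvg_norm; [exact: cx|exact: cy].
have f0 p : 0 <= f p by rewrite addr_ge0.
exists (f m + 1); first by have := f0 m; lra.
move=> p /sE sp; have := Hm p; rewrite inE => /(_ sp); rewrite {1}/f.
by have := normr_ge0 (ux p); have := normr_ge0 (uy p); split; lra.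
Qed.

Lemma cube_le (s : R) : 0 <= s -> s <= 3 / 2 -> s ^+ 3 <= 27 / 8.
Proof.
move=> s0 s1; have -> : 27 / 8 = (3 / 2) ^+ 3 :> R by field.
by rewrite lerXn2r // ?nnegrE // (le_trans s0).
Qed.

(* The maximum of [u - v] over the box can only lie on its left side: the barrier
   [v] is too steep on the right and at the bottom ([eta] only keeps these slopes
   finite), it increases at the top where [uy <= 0], and [barrier_ineq] excludes
   the interior. *)
Lemma ux_bound D u ux uy uxx uxy uyx uyy (K al y0 : R) :
  open D -> C1_partials D u ux uy -> C1_partials D ux uxx uxy ->
  C1_partials D uy uyx uyy -> convex_fun_on D u ->
  (forall p, D p -> {for p, continuous u}) -> square 1 `<=` D ->
  (forall p, D p -> p.2 < 0 -> uy p <= 0) -> 0 < K ->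
  (forall p, D p -> 0 < uxx p * uyy p - uxy p * uyx p) ->
  (forall p, D p -> K ^+ 2 * (1 + (ux p ^+ 2 + uy p ^+ 2)) ^+ 3 =
     (uxx p * uyy p - uxy p * uyx p) ^+ 2) ->
  0 < al < 1 / 6 -> -1 < y0 < - (1 / 2) ->
  ux (1 - 5 * al, y0) <= 3 / (2 * K * al ^+ 2).
Proof.
move=> oD Cu Cx Cy cu cont_u sD uyneg K0 det0 pde /andP[al0 al6] /andP[y0l y0u].
have cont_ux p : D p -> {for p, continuous ux}.
  by case: p => x y Dp; have [] := Cu _ _ Dp.
have cont_uy p : D p -> {for p, continuous uy}.
  by case: p => x y Dp; have [] := Cu _ _ Dp.
have [C C0 HC] := gradient_bounded sD cont_ux cont_uy.
pose c : R := 9 / K.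
have c0 : 0 < c by rewrite divr_gt0.
(* With [27 * C * t <= c] and [root_sum] at most [3 / 2], the barrier is steeper than [C] on the two
   sides where one of its roots is at most [t]; hence the offset [eta = t ^+ 2]. *)
pose t : R := Num.min al (c / (27 * C)).
have t0 : 0 < t by rewrite lt_min al0 divr_gt0 // mulr_gt0.
have [tal tC] : t <= al /\ 27 * C * t <= c.
  split; first by rewrite /t ge_min lexx.
  by rewrite mulrC -ler_pdivlMr ?mulr_gt0 // /t ge_min lexx orbT.
pose eta := t ^+ 2.
have eta0 : 0 < eta by rewrite exprn_gt0.
have eta_al : eta <= al.
  rewrite /eta expr2 (le_trans _ tal) // ler_piMl // ?ltW //.
  by move: tal al6; clear; lra.
(* The box stops [eta] short of the line [x = 1] and starts [eta] above [ys], the lines where the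
   barrier slope is infinite. Its height passes the axis [ys + 2 * al] of [depth], so that [depth1]
   is [- 1 / 2] at the top. *)
pose ys := y0 - eta; pose x1 := 1 - 3 * al; pose x2 := 1 - eta; pose y1 := ys + 3 * al.
have x12 : x1 < x2 by rewrite /x1 /x2; move: eta_al al0; clear; lra.
have y01 : y0 < y1 by rewrite /y1 /ys; move: eta_al al0; clear; lra.
have y1n : y1 < 0 by rewrite /y1 /ys; move: eta0 y0u al6; clear; lra.
pose v := barrier c al ys; pose vx := barrier_x c al ys; pose vy := barrier_y c al ys.
have dep y : y0 <= y <= y1 -> [/\ 0 < depth al ys y, depth al ys y <= al
    & depth al ys y = (y - ys) * (1 - (y - ys) / (4 * al))].
  move=> /andP[ya yb].
  have E : depth al ys y = (y - ys) * (1 - (y - ys) / (4 * al)).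
    by rewrite /depth; ring.
  split => //.
    rewrite E mulr_gt0 //; first by rewrite /ys; move: ya eta0; clear; lra.
    rewrite subr_gt0 ltr_pdivrMr ?mulr_gt0 //.
    by move: yb al0; rewrite /y1; clear; lra.
  rewrite -subr_ge0; have -> : al - depth al ys y = (y - ys - 2 * al) ^+ 2 / (4 * al).
    by rewrite /depth; field; rewrite gt_eqF.
  by rewrite divr_ge0 ?sqr_ge0 // mulr_ge0 // ltW.
pose S := root_sum al ys.
have HS x y : x1 <= x <= x2 -> y0 <= y <= y1 -> 0 < S (x, y) <= 3 / 2.
  move=> /andP[xa xb] yy; have [d0 d1 _] := dep y yy.
  have xlt : x < 1 by apply: le_lt_trans xb _; rewrite /x2 gtrBl.
  rewrite root_sum_gt0 //= /S /root_sum /=.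
  have h1 : Num.sqrt (1 - x) <= 1.
    rewrite -[leRHS]sqrtr1 ler_wsqrtr //.
    by move: xa al6; rewrite /x1; clear; lra.
  have h2 : Num.sqrt (depth al ys y) <= 1.
    by rewrite -[leRHS]sqrtr1 ler_wsqrtr //; move: d1 al6; clear; lra.
  by move: h1 h2; clear; lra.
have inD x y : x1 <= x <= x2 -> y0 <= y <= y1 -> square 1 (x, y).
  move=> /andP[xa xb] /andP[ya yb]; split => /=.
    by move: xa xb eta0 al6; rewrite /x1 /x2; clear; lra.
  by move: ya yb y0l y1n; clear; lra.
pose B : set (R * R) := `[x1, x2] `*` `[y0, y1].
pose w p : R := u p - v p.
have [|||[x y] /set_mem Bz maxz] := @compact_EVT_max _ R w B.
- by exists (x1, y0); split; rewrite /= in_itv /= lexx ltW.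
- by apply: compact_setX; exact: segment_compact.
- apply: continuous_in_subspaceT => p /set_mem [].
  case: p => x y /=; rewrite !in_itv /= => px py.
  have [d0 _ _] := dep y py.
  apply: cvgB; first by apply/cont_u/sD/inD.
  apply: barrier_continuous => //=.
  by case/andP: px => _ h; apply: le_lt_trans h _; rewrite /x2 gtrBl.
have {maxz} maxz a b : x1 <= a <= x2 -> y0 <= b <= y1 -> w (a, b) <= w (x, y).
  by move=> ha hb; apply: maxz; rewrite inE; split; rewrite /= in_itv.
case: Bz; rewrite /= !in_itv /= => hx hy.
have sxy := inD _ _ hx hy; have Dxy := sD _ sxy.
have [HCx HCy] := HC _ sxy.
have [d0 d1 dE] := dep y hy.
have /andP[S0 S1] := HS x y hx hy.
have xlt : x < 1 by case/andP: hx => _ h; apply: le_lt_trans h _; rewrite /x2 gtrBl.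
have [dux duy _ _] := Cu _ _ Dxy.
have dwx : is_derive x 1 (fun s => w (s, y)) (ux (x, y) - vx (x, y)).
  exact: is_deriveB dux (barrier_dx c xlt d0).
have dwy : is_derive y 1 (fun s => w (x, s)) (uy (x, y) - vy (x, y)).
  exact: is_deriveB duy (barrier_dy c al0 xlt d0).
have dwx' : is_derive x 1 (fun s => - w (s, y)) (- (ux (x, y) - vx (x, y))) := is_deriveN dwx.
have dwy' : is_derive y 1 (fun s => - w (x, s)) (- (uy (x, y) - vy (x, y))) := is_deriveN dwy.
have /andP[xa xb] := hx; have /andP[ya yb] := hy.
have S3 : S (x, y) ^+ 3 <= 27 / 8 by apply: cube_le => //; exact: ltW.
have S30 : 0 < S (x, y) ^+ 3 by rewrite exprn_gt0.
have y_bot : y <> y0.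
  move=> yE.
  have b0 : 0 < Num.sqrt (depth al ys y) by rewrite sqrtr_gt0.
  have bt : Num.sqrt (depth al ys y) <= t.
    have -> : t = Num.sqrt (t ^+ 2) by rewrite sqrtr_sqr gtr0_norm.
    rewrite ler_wsqrtr // /depth yE /ys opprB addrCA subrr addr0.
    by rewrite gerBl divr_ge0 ?sqr_ge0 // mulr_ge0 // ltW.
  have vyE : vy (x, y) = - (c * depth1 al ys y / (2 * Num.sqrt (depth al ys y) * S (x, y) ^+ 3)).
    by rewrite /vy /barrier_y /S /=; field; rewrite !gt_eqF.
  have d1h : 1 / 2 <= depth1 al ys y.
    rewrite /depth1 yE /ys opprB addrCA subrr addr0.
    have : eta / (2 * al) <= 1 / 2 by rewrite ler_pdivrMr ?mulr_gt0 //; move: eta_al; clear; lra.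
    by clear; lra.
  have vyC : C <= - vy (x, y).
    rewrite vyE opprK ler_pdivlMr ?mulr_gt0 //.
    have h1 : C * (2 * Num.sqrt (depth al ys y) * S (x, y) ^+ 3) <= C * (2 * t * (27 / 8)).
      apply: ler_wpM2l; first exact: ltW.
      have g1 : 0 <= 2 * Num.sqrt (depth al ys y) by rewrite ltW // mulr_gt0.
      by apply: (ler_pM g1 (ltW S30)) => //; rewrite ler_pM2l.
    have h2 : c * (1 / 2) <= c * depth1 al ys y by rewrite ler_wpM2l // ltW.
    by move: h1 h2 tC c0; clear; lra.
  have pos : - (uy (x, y) - vy (x, y)) < 0.
    by move: HCy vyC => /ltr_normlP[h _]; move: h; clear; lra.
  have r0 : 0 < y1 - y0 by rewrite subr_gt0.
  have [h /andP[h0 hr] [+ _]] := derive_lt0_step dwy' pos r0.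
  rewrite ltrN2 ltNge => /negP; apply; apply: maxz => //.
  by rewrite yE; move: h0 hr; clear; lra.
have y_top : y <> y1.
  move=> yE.
  have b0 : 0 < Num.sqrt (depth al ys y) by rewrite sqrtr_gt0.
  have vyE : vy (x, y) = c / (4 * Num.sqrt (depth al ys y) * S (x, y) ^+ 3).
    rewrite /vy /barrier_y /S /=.
    have -> : depth1 al ys y = - (1 / 2).
      by rewrite /depth1 yE /y1; field; rewrite gt_eqF.
    by field; rewrite !gt_eqF.
  have neg : uy (x, y) - vy (x, y) < 0.
    rewrite subr_lt0 vyE; apply: (@le_lt_trans _ _ 0).
      by apply: uyneg => //=; rewrite yE.
    by rewrite divr_gt0 // !mulr_gt0.
  have r0 : 0 < y1 - y0 by rewrite subr_gt0.
  have [h /andP[h0 hr] [_ +]] := derive_lt0_step dwy neg r0.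
  rewrite ltNge => /negP; apply; apply: maxz => //.
  by rewrite yE; move: h0 hr; clear; lra.
have vxE : vx (x, y) = c / (Num.sqrt (1 - x) * S (x, y) ^+ 3).
  rewrite /vx /barrier_x /S /=; field.
  by rewrite !gt_eqF // sqrtr_gt0 subr_gt0.
have x_right : x <> x2.
  move=> xE.
  have vxC : C <= vx (x, y).
    have aE : Num.sqrt (1 - x) = t.
      by rewrite xE /x2 opprB addrCA subrr addr0 sqrtr_sqr gtr0_norm.
    rewrite vxE aE ler_pdivlMr ?mulr_gt0 //.
    have h1 : C * (t * S (x, y) ^+ 3) <= C * (t * (27 / 8)).
      by rewrite ler_pM2l // ler_pM2l.
    have Ct : 0 < C * t by rewrite mulr_gt0.
    by move: h1 tC c0 Ct; clear; lra.
  have neg : ux (x, y) - vx (x, y) < 0.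
    by move: HCx vxC => /ltr_normlP[_ h]; move: h; clear; lra.
  have r0 : 0 < x2 - x1 by rewrite subr_gt0.
  have [h /andP[h0 hr] [_ +]] := derive_lt0_step dwx neg r0.
  rewrite ltNge => /negP; apply; apply: maxz => //.
  by rewrite xE; move: h0 hr; clear; lra.
have {x_right} xb' : x < x2 by rewrite lt_neqAle xb andbT; apply/eqP.
have {y_bot} ya' : y0 < y by rewrite lt_neqAle ya andbT eq_sym; apply/eqP.
have {y_top} yb' : y < y1 by rewrite lt_neqAle yb andbT; apply/eqP.
have [xE|xN] := eqVneq x x1; last first.
  have xa' : x1 < x by rewrite lt_neqAle xa andbT eq_sym.
  have nx : \forall s \near x, x1 < s < x2 by apply: near_in_itvoo; rewrite in_itv /= xa'.
  have ny : \forall s \near y, y0 < s < y1 by apply: near_in_itvoo; rewrite in_itv /= ya'.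
  have inx s : x1 < s < x2 -> x1 <= s <= x2 by move=> /andP[? ?]; rewrite !ltW.
  have iny s : y0 < s < y1 -> y0 <= s <= y1 by move=> /andP[? ?]; rewrite !ltW.
  have sx s : x1 < s < x2 -> s < 1.
    by move=> /andP[_ h]; apply: lt_le_trans h _; rewrite /x2 gerBl ltW.
  have [ex lx] : ux (x, y) = vx (x, y) /\ uxx (x, y) <= barrier_xx c al ys (x, y).
    have n1 : \forall s \near x, is_derive (s : R) 1 (fun s => - w (s, y))
        (- (ux (s, y) - vx (s, y))).
      apply: filterS nx => s hs; have [ds _ _ _] := Cu _ _ (sD _ (inD _ _ (inx _ hs) hy)).
      apply: is_deriveN; exact: is_deriveB ds (barrier_dx c (sx _ hs) d0).
    have n2 : is_derive x 1 (fun s => - (ux (s, y) - vx (s, y)))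
        (- (uxx (x, y) - barrier_xx c al ys (x, y))).
      have [ds _ _ _] := Cx _ _ Dxy.
      apply: is_deriveN; exact: is_deriveB ds (barrier_dxx c xlt d0).
    have n3 : \forall s \near x, - w (x, y) <= - w (s, y).
      by apply: filterS nx => s hs; rewrite lerN2; apply: maxz => //; exact: inx.
    by have [] := second_derivative_test n1 n2 n3; clear; split; lra.
  have [ey ly] : uy (x, y) = vy (x, y) /\ uyy (x, y) <= barrier_yy c al ys (x, y).
    have n1 : \forall s \near y, is_derive (s : R) 1 (fun s => - w (x, s))
        (- (uy (x, s) - vy (x, s))).
      apply: filterS ny => s hs; have [_ ds _ _] := Cu _ _ (sD _ (inD _ _ hx (iny _ hs))).
      have [ds0 _ _] := dep s (iny _ hs).
      apply: is_deriveN; exact: is_deriveB ds (barrier_dy c al0 xlt ds0).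
    have n2 : is_derive y 1 (fun s => - (uy (x, s) - vy (x, s)))
        (- (uyy (x, y) - barrier_yy c al ys (x, y))).
      have [_ ds _ _] := Cy _ _ Dxy.
      apply: is_deriveN; exact: is_deriveB ds (barrier_dyy c al0 xlt d0).
    have n3 : \forall s \near y, - w (x, y) <= - w (x, s).
      by apply: filterS ny => s hs; rewrite lerN2; apply: maxz => //; exact: iny.
    by have [] := second_derivative_test n1 n2 n3; clear; split; lra.
  have dxy := det0 _ Dxy; have pxy := pde _ Dxy.
  (* Equality of the mixed derivatives makes the dropped term a square; the comparison then involves
     only pure second derivatives of the barrier. *)
  have detle : uxx (x, y) * uyy (x, y) - uxy (x, y) * uyx (x, y) <= uxx (x, y) * uyy (x, y).
    by rewrite gerBl -(second_partials_comm oD Cu Cx Cy Dxy) -expr2 sqr_ge0.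
  have uxx0 := convex_uxx_ge0 oD Cu Cx cu Dxy.
  have uyy0 : 0 <= uyy (x, y).
    rewrite leNgt; apply/negP => neg; have := mulr_ge0_le0 uxx0 (ltW neg).
    by rewrite leNgt (lt_le_trans dxy detle).
  have prod := le_trans detle (ler_pM uxx0 uyy0 lx ly).
  have a0 : 0 < Num.sqrt (1 - x) by rewrite sqrtr_gt0 subr_gt0.
  have b0 : 0 < Num.sqrt (depth al ys y) by rewrite sqrtr_gt0.
  have aal : Num.sqrt (1 - x) ^+ 2 <= 3 * al.
    rewrite sqr_sqrtr; last by rewrite subr_ge0 ltW.
    by move: xa; rewrite /x1; clear; lra.
  have g2 : depth1 al ys y ^+ 2 = 1 - Num.sqrt (depth al ys y) ^+ 2 / al.
    by rewrite depth1_sq // sqr_sqrtr // ltW.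
  have := barrier_ineq K0 al0 a0 b0 aal g2 (erefl c) (erefl (S (x, y))) erefl erefl
    erefl erefl (erefl (vx (x, y))) (erefl (vy (x, y)))
    (erefl (barrier_xx c al ys (x, y))) (erefl (barrier_yy c al ys (x, y))).
  rewrite -ex -ey pxy ltNge => /negP; case.
  by rewrite ler_sqr // nnegrE; [exact: ltW|exact: le_trans (ltW dxy) prod].
have a0 : 0 < Num.sqrt (1 - x) by rewrite sqrtr_gt0 subr_gt0.
have a2 : Num.sqrt (1 - x) ^+ 2 = 3 * al.
  by rewrite sqr_sqrtr ?subr_ge0 ?ltW // xE /x1; ring.
have ux_le : ux (x, y) <= vx (x, y).
  rewrite leNgt; apply/negP => gt.
  have neg : - (ux (x, y) - vx (x, y)) < 0 by rewrite oppr_lt0 subr_gt0.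
  have r0 : 0 < x2 - x1 by rewrite subr_gt0.
  have [h /andP[h0 hr] [+ _]] := derive_lt0_step dwx' neg r0.
  rewrite ltrN2 ltNge => /negP; apply; apply: maxz => //.
  by rewrite xE; move: h0 hr; clear; lra.
have uyz : uy (x, y) <= 0 by apply: uyneg => //=; exact: lt_trans yb' _.
have sx0 : square 1 (1 - 5 * al, y0).
  by split => /=; [move: al0 al6; clear; lra|move: y0l y0u; clear; lra].
have sx1 : square 1 (x, y0).
  by apply: inD => //; rewrite lexx ltW.
have D0 := sD _ sx0; have D1 := sD _ sx1.
(* Tangent planes at the maximum and at the target point. Together with [t3] they give [2 * al * ux
   (1 - 5 * al, y0) <= v (x, y0) - v (x, y) + 2 * al * vx (x, y)]. *)
have t1 := convex_above_tangent oD Cu cu Dxy D0.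
have t2 := convex_above_tangent oD Cu cu D0 D1.
have t3 : w (x, y0) <= w (x, y) by apply: maxz => //; rewrite lexx ltW.
rewrite /= in t1 t2.
have dy00 : y0 <= y0 <= y1 by rewrite lexx ltW.
have /andP[S00 _] := HS x y0 hx dy00.
have v0 : v (x, y0) <= c / (3 * al).
  have rs : Num.sqrt (1 - x) <= root_sum al ys (x, y0).
    by rewrite /root_sum /= lerDl mulr_ge0.
  rewrite /v /barrier ler_pM2l // lef_pV2 ?posrE ?mulr_gt0 ?exprn_gt0 //.
  by rewrite -a2 ler_sqr // nnegrE ltW.
(* This absorbs the terms at the maximum: with [a] the root of [1 - x], the quotient of the two
   sides is [2 * al / (a * S)], where [a ^+ 2 = 3 * al] and [S >= a]. *)
have vz : 2 * al * vx (x, y) <= v (x, y).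
  rewrite vxE /v /barrier -/S.
  have -> : 2 * al * (c / (Num.sqrt (1 - x) * S (x, y) ^+ 3)) =
    c * (S (x, y) ^+ 2)^-1 * (2 * al / (Num.sqrt (1 - x) * S (x, y))).
    by field; rewrite !gt_eqF.
  rewrite ler_piMr //; first by rewrite mulr_ge0 // ?invr_ge0 ?sqr_ge0 // ltW.
  rewrite ler_pdivrMr ?mulr_gt0 // mul1r.
  apply: (@le_trans _ _ (Num.sqrt (1 - x) ^+ 2)); first by rewrite a2; move: al0; clear; lra.
  by rewrite expr2 ler_pM2l // /S /root_sum /= lerDl mulr_ge0.
have h1 : 0 <= (y0 - y) * uy (x, y) by rewrite mulr_le0 // subr_le0 ltW.
have h2 : 2 * al * ux (x, y) <= 2 * al * vx (x, y) by rewrite ler_pM2l // mulr_gt0.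
have x1E : x = 1 - 3 * al by [].
have P : 2 * al * ux (1 - 5 * al, y0) <= c / (3 * al).
  rewrite subrr mul0r addr0 in t2.
  have e2 : (x - (1 - 5 * al)) = 2 * al by rewrite x1E; ring.
  have e1 : (1 - 5 * al - x) = - (2 * al) by rewrite x1E; ring.
  rewrite e2 in t2; rewrite e1 in t1.
  by move: t1 t2 t3 v0 vz h1 h2; rewrite /w; clear; lra.
have al2 : 0 < 2 * al by rewrite mulr_gt0.
rewrite -(ler_pM2l al2); apply: le_trans P _.
rewrite le_eqVlt; apply/orP; left; apply/eqP.
by rewrite /c; field; rewrite !gt_eqF.
Qed.

End BoxBound.

(** * Area and cotangent *)

Section Area.
Variable R : realType.
Implicit Types D : set (R * R).
Local Notation mu := (@lebesgue_measure R \x @lebesgue_measure R)%E.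

(** Measurability refers to the product sigma-algebra, so the open set is written as a countable
    union of squares with rational centre and radius. *)
Lemma open_plane_measurable D : open D ->
  measurable (D : set (measurableTypeR R * measurableTypeR R)).
Proof.
move=> oD.
pose cell (a b r : rat) : set (measurableTypeR R * measurableTypeR R) :=
  `]ratr a - ratr r, ratr a + ratr r[%classic `*` `]ratr b - ratr r, ratr b + ratr r[%classic.
have -> : D = \bigcup_a \bigcup_b \bigcup_r
    (if `[< cell a b r `<=` D >] then cell a b r else set0).
  apply/seteqP; split => [[x y] Dxy|p [a _ [b _ [r _]]]]; last first.
    by case: asboolP => // sub; exact: sub.
  have [e e0 He] := open_planeP oD Dxy.
  have e2 : 0 < e / 2 by rewrite divr_gt0.
  have [r] := rat_in_itvoo e2; rewrite in_itv /= => /andP[r0 r1].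
  have [|a] := @rat_in_itvoo R (x - ratr r) x; first by rewrite gtrBl.
  rewrite in_itv /= => /andP[a0 a1].
  have [|b] := @rat_in_itvoo R (y - ratr r) y; first by rewrite gtrBl.
  rewrite in_itv /= => /andP[b0 b1].
  have sub : cell a b r `<=` D.
    move=> [x' y'] [] /=; rewrite !in_itv /= => /andP[x0 x1] /andP[y0 y1].
    have := He (x' - x) (y' - y); rewrite /= !subrKC; apply.
      by rewrite ltr_norml; move: a0 a1 x0 x1 r1; clear; lra.
    by rewrite ltr_norml; move: b0 b1 y0 y1 r1; clear; lra.
  exists a => //; exists b => //; exists r => //.
  rewrite (introT (asboolP _) sub).
  by split; rewrite /= in_itv /=; move: a0 a1 b0 b1 r0; clear; lra.
apply: bigcupT_measurable_rat => a; apply: bigcupT_measurable_rat => b.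
apply: bigcupT_measurable_rat => r; case: ifP => // _.
by apply: measurableX; exact: measurable_itv.
Qed.

Lemma square_prod (a : R) : square a = `[- a, a]%classic `*` `[- a, a]%classic.
Proof.
by apply/seteqP; split=> -[x y]; rewrite /square /= !in_itv.
Qed.

Lemma square_measurable (a : R) :
  measurable (square a : set (measurableTypeR R * measurableTypeR R)).
Proof. by rewrite square_prod; apply: measurableX; exact: measurable_itv. Qed.

Lemma square_measure (a : R) : 0 <= a -> mu (square a) = ((2 * a) ^+ 2)%:E.
Proof.
move=> a0; rewrite square_prod product_measure1E; try exact: measurable_itv.
have L : lebesgue_measure (`[- a, a]%classic : set R) = (2 * a)%:E.
  rewrite lebesgue_measure_itv /= lte_fin; case: ltP => h.
    by rewrite -EFinD; congr (_%:E); ring.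
  by have -> : a = 0; [move: a0 h; clear; lra|rewrite mulr0].
transitivity ((2 * a)%:E * (2 * a)%:E)%E; first by congr (_ * _)%E; exact: L.
by rewrite -EFinM expr2.
Qed.

Lemma area_bounds D : open D -> square 1 `<=` D -> D `<=` square (4 / 3) ->
  4 <= area D <= 64 / 9.
Proof.
move=> oD s1 s2.
have mD := open_plane_measurable oD.
have lo : (4%:E <= mu D)%E.
  have -> : 4%:E = mu (square 1) by rewrite square_measure //; congr (_%:E); ring.
  by apply: le_measure => //; rewrite inE //; exact: square_measurable.
have hi : (mu D <= (64 / 9)%:E)%E.
  have -> : (64 / 9)%:E = mu (square (4 / 3)).
    by rewrite square_measure ?divr_ge0 //; congr (_%:E); field.
  by apply: le_measure => //; rewrite inE //; exact: square_measurable.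
(* The two bounds make the measure finite, so [fine] does not fall back on its default value 0. *)
rewrite /area; move: lo hi; case: (mu D) => [r||] //=.
by rewrite !lee_fin => -> ->.
Qed.

Lemma sin_le_id (x : R) : 0 <= x -> sin x <= x.
Proof.
move=> x0.
have df (y : R) : y \in `]0, x[%R -> is_derive y 1 (fun t => sin t - t) (cos y - 1).
  by move=> _; exact: is_deriveB.
have cf : {within `[0, x], continuous (fun t : R => sin t - t)}.
  by apply: continuous_subspaceT => y; apply: cvgB; [exact: continuous_sin|exact: cvg_id].
have [c _ E] := MVT_segment x0 df cf.
move: E; rewrite sin0 !subr0 => E.
rewrite -subr_le0 E mulr_le0_ge0 // subr_le0; exact: cos_le1.
Qed.

(** From [cos x = 1 - 2 * sin (x / 2) ^+ 2 >= 1 - x ^+ 2 / 2] and [sin x <= x]. The factor [8 / 9]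
    is the one that the area bound [64 / 9] calls for; the range [1 / 18] covers [pi * al ^+ 2 / 2]
    for [al < 1 / 6]. *)
Lemma cot_lower_bound (x : R) : 0 < x <= 1 / 18 -> 8 / (9 * x) <= cot x.
Proof.
move=> /andP[x0 x1].
have sx := sin_le_id (ltW x0).
have sx2 := @sin_le_id (x / 2); have x20 : 0 <= x / 2 by lra.
have {}sx2 := sx2 x20.
have s0 : 0 < sin x.
  by apply: sin_gt0_pi; rewrite x0 /=; have := @pi_ge2 R; lra.
have s20 : 0 <= sin (x / 2).
  by apply: sin_ge0_pi; rewrite x20 /=; have := @pi_ge2 R; lra.
have cx : 8 / 9 <= cos x.
  have -> : x = (x / 2) *+ 2 by rewrite mulr2n -splitr.
  rewrite cos_mulr2n cos2sin2 mulr2n.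
  have : sin (x / 2) ^+ 2 <= (x / 2) ^+ 2 by rewrite lerXn2r // nnegrE.
  by nra.
rewrite /cot ler_pdivrMr ?mulr_gt0 // mulrAC ler_pdivlMr //.
by nra.
Qed.

End Area.

(** * Assembly of the estimate *)

Lemma Ck_partials (R : realType) (D : set (R * R)) (f : R * R -> R) :
  (forall x, D x -> derivable (fun t => f (t, x.2)) x.1 1 /\
                    derivable (fun t => f (x.1, t)) x.2 1) ->
  (forall x, D x -> {for x, continuous (pdx f)}) ->
  (forall x, D x -> {for x, continuous (pdy f)}) ->
  C1_partials D f (pdx f) (pdy f).
Proof.
move=> df cx cy x y Dxy; split; [| |exact: cx|exact: cy]; move: (df _ Dxy).
  by case=> /derivableP dx _; rewrite /pdx derive1E.
by case=> _ /derivableP dy; rewrite /pdy derive1E.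
Qed.

(** Trades the real power for a polynomial, the form in which the barrier inequality is stated. *)
Lemma powR_three_halves_sq (R : realType) (x : R) : 0 <= x ->
  (x `^ (3 / 2)) ^+ 2 = x ^+ 3.
Proof.
move=> x0; rewrite -powR_mulrn ?powR_ge0 // -powRrM -powR_mulrn //.
by congr (_ `^ _); field.
Qed.

Unset Implicit Arguments.

Theorem theorem4p4 (R : realType) (Omega : set (R * R)) (u : R * R -> R) :
  open Omega ->
  strictly_convex_set Omega ->
  smooth_boundary Omega ->
  axially_symmetric Omega ->
  square 1 `<=` Omega ->
  Omega `<=` square (4 / 3) ->
  Ck 2 Omega u ->
  convex_fun_on Omega u ->
  (forall p, Omega p ->
     hess_det u p / (1 + enorm (grad u p) ^+ 2) `^ (3 / 2) = 2 * pi / area Omega) ->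
  grad_blowup Omega u ->
  forall eps alpha : R, 0 < eps < 1 / 2 -> 0 < alpha < 1 / 6 ->
    pdx u (1 - 5 * alpha, -1 + eps) <= 2 + 3 * cot (pi * alpha ^+ 2 / 2).
Proof.
move=> oD scD _ aD s1 s2 Cu2 cu pde bu eps al /andP[eps0 eps2] al01.
have [cont_u [du [Cux Cuy]]] := Cu2.
have [cont_ux [dux [cont_uxx cont_uxy]]] := Cux.
have [cont_uy [duy [cont_uyx cont_uyy]]] := Cuy.
have Cu := Ck_partials du cont_ux cont_uy.
have Cx := Ck_partials dux cont_uxx cont_uxy.
have Cy := Ck_partials duy cont_uyx cont_uyy.
have /andP[A4 A64] := area_bounds oD s1 s2.
have A0 : 0 < area Omega by apply: lt_le_trans A4.
have pi0 := @pi_gt0 R.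
set K := 2 * pi / area Omega in pde.
have K0 : 0 < K by rewrite divr_gt0 // mulr_gt0.
have D0 : Omega (0, 0) by apply: s1; split; rewrite /= lerN10 ler01.
have hess p : Omega p -> hess_det u p =
    K * (1 + (pdx u p ^+ 2 + pdy u p ^+ 2)) `^ (3 / 2).
  move=> Op; have := pde p Op.
  rewrite /grad /enorm sqr_sqrtr ?addr_ge0 ?sqr_ge0 //= => <-.
  rewrite divfK // gt_eqF // powR_gt0 // ltr_pwDl // addr_ge0 ?sqr_ge0 //.
(* The absolute value makes [G] positive at every real argument, as the reflection lemmas ask; on
   squared gradients it changes nothing. *)
pose G (r : R) : R := K * (1 + `|r|) `^ (3 / 2).
have G0 (r : R) : 0 < G r by rewrite mulr_gt0 // powR_gt0 // ltr_pwDl.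
have pdeG p : Omega p -> pdx (pdx u) p * pdy (pdy u) p - pdy (pdx u) p * pdx (pdy u) p =
    G (pdx u p ^+ 2 + pdy u p ^+ 2).
  by move=> Op; rewrite -/(hess_det u p) hess // /G ger0_norm // addr_ge0 ?sqr_ge0.
have uyneg p : Omega p -> p.2 < 0 -> pdy u p <= 0.
  exact: (uy_le0 oD scD aD D0 s2 cont_u Cu Cx Cy cu bu pdeG G0).
have y01 : -1 < -1 + eps < - (1 / 2) by move: eps0 eps2; clear; lra.
have bound : pdx u (1 - 5 * al, -1 + eps) <= 3 / (2 * K * al ^+ 2).
  apply: (ux_bound oD Cu Cx Cy cu cont_u s1 uyneg K0 _ _ al01 y01).
    by move=> p Op; rewrite pdeG.
  move=> p Op; have g0 : 0 <= pdx u p ^+ 2 + pdy u p ^+ 2 by rewrite addr_ge0 ?sqr_ge0.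
  by rewrite pdeG // /G [RHS]exprMn powR_three_halves_sq ger0_norm // addr_ge0.
case/andP: al01 => al0 al6.
have al20 : 0 < al ^+ 2 by rewrite exprn_gt0.
have al36 : al ^+ 2 <= 1 / 36.
  have -> : 1 / 36 = (1 / 6) ^+ 2 :> R by field.
  by rewrite ler_sqr ?nnegrE ?divr_ge0 // ltW.
have x18 : 0 < pi * al ^+ 2 / 2 <= 1 / 18.
  rewrite divr_gt0 ?mulr_gt0 //=.
  have [_ pi2] := andP (@pihalf_02 R).
  have : pi / 2 * al ^+ 2 <= 2 * (1 / 36) by apply: ler_pM => //; rewrite ltW // divr_gt0.
  by clear; lra.
have := cot_lower_bound x18.
(* After substitution of [K] both sides have denominator [4 * pi * al ^+ 2], and the inequality
   becomes [3 * area Omega <= 64 / 3], the upper area bound. *)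
have : 3 / (2 * K * al ^+ 2) <= 3 * (8 / (9 * (pi * al ^+ 2 / 2))).
  rewrite /K; move: A64 pi0 A0; move: (area Omega) (@pi R) => A P A64 P0 A0.
  have -> : 3 / (2 * (2 * P / A) * al ^+ 2) = 3 * A / (4 * P * al ^+ 2).
    by field; rewrite !gt_eqF.
  have -> : 3 * (8 / (9 * (P * al ^+ 2 / 2))) = 64 / 3 / (4 * P * al ^+ 2) :> R.
    by field; rewrite !gt_eqF.
  rewrite ler_pM2r ?invr_gt0 ?mulr_gt0 //.
  by move: A64; clear; lra.
by move: bound; clear; lra.
Qed.
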